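(* For all $x\ge 1$ we have $$-\frac{1}{6}\log_2 x-\frac{7}{12}<S_3(x)-\frac{x}{12}\le\frac16\log_2 x-\frac16.$$ In particular, the natural density of the set $S_3$ in $\mathbb{N}$ exists and is equal to $$\lim_{x\to+\infty}\frac{S_3(x)}{x}=\frac1{12}.$$ Moreover, there exist increasing sequences $(m_l)_{l\in\mathbb{N}},(n_l)_{l\in\mathbb{N}}\subset\mathbb{N}$ such that $$S_3(m_l)-\frac{m_l}{12}\sim\frac16\log_2 m_l,\qquad S_3(n_l)-\frac{n_l}{12}\sim-\frac16\log_2 n_l.$$
   Context: $\mathbb{N}$ is the set of non-negative integers. $b_3(n)$ is the number of partitions of $n$ into powers of two where each part has one of $3$ colors, i.e. $\sum_{n\ge 0} b_3(n)x^n=\prod_{j\ge 0}(1-x^{2^j})^{-3}$. Let $S_3=\{n\in\mathbb{N}: b_3(n)\neq x^2+y^2+z^2\text{ for any }x,y,z\in\mathbb{Z}\}$, and for real $x\ge 0$ let $S_3(x)=\#(S_3\cap[0,x])$ be its counting function. Here $x$ denotes a real number in the bounds and the limit, and $a_l\sim c_l$ means $a_l/c_l\to 1$ as $l\to\infty$.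
   Formalization: The upper bound S_3(x) - x/12 <= (1/6) log_2 x - 1/6 is stated for x >= 2 instead of x >= 1, since it fails at x = 1, where S_3(1) = 0 and -1/12 > -1/6; everything else is as printed. *)

(* Defs.v *)
From HB Require Import structures.
From mathcomp Require Import all_boot all_order all_algebra finmap.
From mathcomp Require Import all_classical all_reals all_analysis.

Set Implicit Arguments.
Unset Strict Implicit.
Unset Printing Implicit Defensive.

Import Order.TTheory GRing.Theory Num.Theory.
Import numFieldNormedType.Exports.

Local Open Scope classical_set_scope.
Local Open Scope ring_scope.

(* A partition of n into powers of two with m colors is encoded by its          *)
(* multiplicities: f (c, j) is the number of parts 2 ^ j of color c.            *)
(* Bounding j and f (c, j) by n loses nothing, as j < 2 ^ j and a part of a     *)
(* partition of n, like its multiplicity, is at most n.                         *)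
Definition colored_binary_partitions (m n : nat) :
    {set {ffun 'I_m * 'I_n.+1 -> 'I_n.+1}} :=
  [set f : {ffun 'I_m * 'I_n.+1 -> 'I_n.+1} |
     (\sum_p (f p * 2 ^ p.2) == n)%N]%SET.

Definition b (m n : nat) : nat := #|colored_binary_partitions m n|.

Definition S3 : set nat :=
  [set n | ~ exists x y z : int, (b 3 n)%:Z = x ^+ 2 + y ^+ 2 + z ^+ 2].

Definition upto (R : realType) (A : set nat) (x : R) : set nat :=
  [set n | A n /\ n%:R <= x].

(* [fset_set] is only meaningful on finite sets *)
Lemma finite_upto (R : realType) (A : set nat) (x : R) : finite_set (upto A x).
Proof.
apply: (sub_finite_set _ (finite_II (Num.truncn x).+1)) => n [_ nx] /=.
have [x0|x0] := leP 0 x; last by have := le_lt_trans nx x0; rewrite ltrn0.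
by rewrite ltnS truncn_ge_nat.
Qed.

Definition counting_fun (R : realType) (A : set nat) (x : R) : nat :=
  #|` fset_set (upto A x)|%fset.

Definition has_natural_density (R : realType) (A : set nat) (d : R) : Prop :=
  (counting_fun A (n%:R : R))%:R / n%:R @[n --> \oo] --> d.

Definition log2 (R : realType) (x : R) : R := ln x / ln 2.

(* Totality of division is harmless: only the terms for large l matter. *)
Definition asymp_equiv (R : realType) (a c : nat -> R) : Prop :=
  a l / c l @[l --> \oo] --> (1 : R).

(* Main.v *)
(* Let t = prod_j (1 - x^(2^j)) be the Thue-Morse series, so that b 3 n is the
   coefficient of x^n in 1 / t^3. Modulo 32 the coefficient of x^n in
   1 / (t^3 (1 - x)^4) depends only on the last two binary digits of n and on the
   parities of its digit sum and of its number of blocks 11. Hence, for k > 0, the four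
   values b 3 (4k + r), r < 4, are a permutation of 4, 12, 20, 28 modulo 32 if
   t_(k-1) = t_k, and are all 2 modulo 4 otherwise. By the three squares theorem S3
   has exactly one element in each block 4k, ..., 4k + 3 of the first kind and none in
   the others. The number O(K) of blocks of the first kind with 1 <= k <= K satisfies
   O(2K + e) = K - O(K), so that appending two binary digits e1 e0 to K changes
   O(K) - K / 3 by (e1 - e0) / 3: this gives the logarithmic bounds, which are
   attained along K = 1010...10 and K = 101...01 in base 2.

   For the three squares theorem let n be squarefree and n <> 7 modulo 8. There is a
   q = 1 modulo 4, prime or equal to 1, such that for Q = q or Q = 2q the number - Q is
   a square modulo n and n is a square modulo Q; by the pigeonhole principle
   z^2 + Q w^2 = n t^2 has a nonzero solution, and as Q is a sum of two rational
   squares, n is a sum of three rational squares, hence of three integral squares by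
   the Davenport-Cassels descent. The conditions on q only prescribe values of
   quadratic characters, so that a version of Dirichlet's theorem for real
   characters suffices. It is proved with finite sums only: the nonvanishing of
   L(1, chi) becomes a lower bound for the partial sums of chi(k) / k, and
   sum chi(d) Lambda(d) / d is bounded for nonprincipal chi but unbounded for the
   principal one. *)

Require Import Defs.
From HB Require Import structures.
From mathcomp Require Import all_boot all_order all_algebra finmap.
From mathcomp Require Import cyclic galois finfield.
From mathcomp Require Import all_classical all_reals all_analysis.
From mathcomp Require Import zify ring lra.
Import Order.TTheory GRing.Theory Num.Theory.
Local Open Scope ring_scope.

(** * Colored binary partitions modulo 32 *)

Section DigitRecursion.
Context {T : Type} (g : bool -> nat -> T -> T) (a : T).

(** Halving is not a structural recursion, hence the fuel; [n] units suffice, since halving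
    decreases every positive number. *)
Fixpoint digit_rec_fuel (fuel n : nat) : T :=
  if fuel is f.+1 then
    if n == 0%N then a else g (odd n) n./2 (digit_rec_fuel f n./2)
  else a.

Definition digit_rec n := digit_rec_fuel n n.

Lemma digit_rec_fuelE f n : (n <= f)%N -> digit_rec_fuel f n = digit_rec n.
Proof.
rewrite /digit_rec; elim/ltn_ind: n f => -[|n] IH [|f] //= le_nf.
rewrite ltnS in le_nf.
have hn : (uphalf n <= n)%N by rewrite -{2}(half_double n) uphalf_half; lia.
by rewrite !IH ?leqnn // (leq_trans hn).
Qed.

Lemma digit_recE n : (0 < n)%N -> digit_rec n = g (odd n) n./2 (digit_rec n./2).
Proof.
case: n => // n _; rewrite {1}/digit_rec [LHS]/= digit_rec_fuelE //.
by have := odd_double_half n.+1; lia.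
Qed.

Lemma digit_rec_double (c : bool) n : (0 < c + n.*2)%N ->
  digit_rec (c + n.*2) = g c n (digit_rec n).
Proof.
by move=> /digit_recE ->; rewrite half_bit_double oddD odd_double addbF oddb.
Qed.
End DigitRecursion.

Definition thue_morse : nat -> bool := digit_rec (fun c _ x => c (+) x) false.

(* Parity of the number of digits 1 plus the number of blocks 11. *)
Definition digit_twist : nat -> bool :=
  digit_rec (fun c n x => c (+) (c && odd n) (+) x) false.

Lemma thue_morse_double (c : bool) n : thue_morse (c + n.*2) = c (+) thue_morse n.
Proof.
case: (posnP (c + n.*2)) => [z|]; last exact: digit_rec_double.
by have [-> ->] : c = false /\ n = 0%N by case: (c) z => //=; lia.
Qed.

Lemma digit_twist_double (c : bool) n :
  digit_twist (c + n.*2) = c (+) (c && odd n) (+) digit_twist n.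
Proof.
case: (posnP (c + n.*2)) => [z|]; last exact: digit_rec_double.
by have [-> ->] : c = false /\ n = 0%N by case: (c) z => //=; lia.
Qed.

(* Modulo 32 this is the coefficient of x^n in (1 - x)^(-4) \sum_n b 3 n x^n. *)
Definition quad_sum (n : nat) : int :=
  (-1) ^+ thue_morse n * (1 + 8 * (odd n)%:Z
    + 16 * (digit_twist n (+) odd n./2 : nat)%:Z).

(** [b1] and [b0] are the last two binary digits; [t], [c], [o] are the Thue-Morse bit, the twist
    and the parity of what remains without them. As only bits enter, congruences become finite
    checks. *)
Definition quad_sum_digits (t c o b1 b0 : bool) : int :=
  (-1) ^+ (b0 (+) (b1 (+) t)) *
  (1 + 8 * (b0 : nat)%:Z
   + 16 * ((b0 (+) (b0 && b1) (+) (b1 (+) (b1 && o) (+) c)) (+) b1 : nat)%:Z).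

Lemma quad_sumE (b1 b0 : bool) n :
  quad_sum (b0 + (b1 + n.*2).*2) =
  quad_sum_digits (thue_morse n) (digit_twist n) (odd n) b1 b0.
Proof.
rewrite /quad_sum !thue_morse_double !digit_twist_double half_bit_double.
by rewrite !oddD !odd_double !addbF !oddb.
Qed.

(** The coefficient of x^n in (1 - x)^4 times the series of [quad_sum]. Without the test [i <= n],
    truncated subtraction would yield [quad_sum 0] instead of 0. *)
Definition b3_approx (n : nat) : int :=
  let d i := if (i <= n)%N then quad_sum (n - i) else 0 in
  d 0%N - 4 * d 1%N + 6 * d 2 - 4 * d 3 + d 4.

(* The value of quad_sum at i + w n, computed from the digit data x0 of n and x1
   of n + 1; only w = 4 and w = 8 are meant. *)
Definition quad_sum_at (w : nat) (x0 x1 : bool * bool * bool) (i : nat) : int :=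
  let: (t, c, o) := if (i < w)%N then x0 else x1 in
  let j := (i %% w)%N in
  if w == 8 then
    let b2 := (4 <= j)%N in
    quad_sum_digits (b2 (+) t) (b2 (+) (b2 && o) (+) c) b2 (odd (j./2)) (odd j)
  else quad_sum_digits t c o (odd (j./2)) (odd j).

Lemma quad_sum_at8 n i : (i < 16)%N ->
  quad_sum (i + 8 * n) =
  quad_sum_at 8 (thue_morse n, digit_twist n, odd n)
    (thue_morse n.+1, digit_twist n.+1, odd n.+1) i.
Proof.
have H (b0 b1 b2 : bool) m : quad_sum (b0 + (b1 + (b2 + m.*2).*2).*2) =
  quad_sum_digits (b2 (+) thue_morse m) (b2 (+) (b2 && odd m) (+) digit_twist m)
    b2 b1 b0.
  by rewrite quad_sumE thue_morse_double digit_twist_double oddD odd_double addbF oddb.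
move=> i16; rewrite /quad_sum_at; set j := (i %% 8)%N.
set m := if (i < 8)%N then n else n.+1.
have -> : (i + 8 * n = odd j + (odd j./2 + ((4 <= j) + m.*2).*2).*2)%N.
  by rewrite {}/j {}/m; do 16! [case: i i16 => [|i] i16 //=; try lia].
by rewrite H /m; case: ifP.
Qed.

Lemma quad_sum_at4 n i : (i < 8)%N ->
  quad_sum (i + 4 * n) =
  quad_sum_at 4 (thue_morse n, digit_twist n, odd n)
    (thue_morse n.+1, digit_twist n.+1, odd n.+1) i.
Proof.
move=> i8; rewrite /quad_sum_at; set j := (i %% 4)%N.
set m := if (i < 4)%N then n else n.+1.
have -> : (i + 4 * n = odd j + (odd j./2 + m.*2).*2)%N.
  by rewrite {}/j {}/m; do 8! [case: i i8 => [|i] i8 //=; try lia].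
by rewrite quad_sumE /m; case: ifP.
Qed.

Lemma b3_approxE n : (4 <= n)%N -> b3_approx n =
  quad_sum (n - 0) - 4 * quad_sum (n - 1) + 6 * quad_sum (n - 2)
  - 4 * quad_sum (n - 3) + quad_sum (n - 4).
Proof. by move=> n4; rewrite /b3_approx !(leq_trans _ n4). Qed.

(** The recurrence [b3_rec], transferred to the approximation. From 8 on every index involved,
    [n./2] included, is at least 4, so no fourth difference is cut off. *)
Lemma b3_approx_step n : (8 <= n)%N ->
  (b3_approx n = 3 * b3_approx (n - 1) - 3 * b3_approx (n - 2) + b3_approx (n - 3)
     + (if odd n then 0 else b3_approx n./2) %[mod 32])%Z.
Proof.
move=> n8; rewrite !b3_approxE ?leq_subRL; try lia.
have [k [r [-> r8]]] : exists k r, (n = r + 8 * k.+1 /\ r < 8)%N.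
  by exists (n %/ 8).-1, (n %% 8)%N; lia.
have q8 i : (i < 8)%N -> quad_sum (r + 8 * k.+1 - i) =
  quad_sum_at 8 (thue_morse k, digit_twist k, odd k)
    (thue_morse k.+1, digit_twist k.+1, odd k.+1) (r + 8 - i).
  by move=> i8; rewrite -quad_sum_at8; [congr quad_sum|]; lia.
have q4 i : (i < 5)%N -> quad_sum ((r + 8 * k.+1)./2 - i) =
  quad_sum_at 4 (thue_morse k, digit_twist k, odd k)
    (thue_morse k.+1, digit_twist k.+1, odd k.+1) (r./2 + 4 - i).
  by move=> i8; rewrite -quad_sum_at4; [congr quad_sum|]; lia.
rewrite -!subnDA !q8 // !q4 // oddD oddM /= addbF.
(* The congruence holds for arbitrary values of these five bits, so 32 cases for each [r] settle
   it. *)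
generalize (thue_morse k) (digit_twist k) (thue_morse k.+1) (digit_twist k.+1) (odd k).
clear q8 q4 n8; case: r r8 => [|[|[|[|[|[|[|[|//]]]]]]]] _;
by do 5! case; vm_compute.
Qed.

(* For n > 0 this says that the 2-adic valuation of n is odd. *)
Definition same_sign n := thue_morse n.-1 == thue_morse n.

Lemma b3_approx_block k r : (0 < k)%N -> (r < 4)%N -> b3_approx (r + 4 * k) =
  let x0 := (thue_morse k.-1, digit_twist k.-1, odd k.-1) in
  let x1 := (thue_morse k, digit_twist k, odd k) in
  quad_sum_at 4 x0 x1 (r + 4) - 4 * quad_sum_at 4 x0 x1 (r + 3)
  + 6 * quad_sum_at 4 x0 x1 (r + 2) - 4 * quad_sum_at 4 x0 x1 (r + 1)
  + quad_sum_at 4 x0 x1 r.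
Proof.
case: k => // k _ r4; rewrite b3_approxE; last lia.
change k.+1.-1 with k; cbv zeta; rewrite -!quad_sum_at4; try lia.
have E (i j : nat) : (i <= 4)%N -> j = (4 - i)%N ->
    (r + 4 * k.+1 - i = r + j + 4 * k)%N by lia.
by rewrite (E 0%N 4%N) // (E 1%N 3%N) // (E 2%N 2%N) // (E 3%N 1%N) // (E 4%N 0%N) ?addn0.
Qed.

(** 28 stands out as 4 * 7, the others being 4 times 1, 3 and 5. When the Thue-Morse bits agree,
    four bits describe the blocks [k.-1] and [k], and all 16 cases are checked. *)
Lemma b3_approx_same_sign k : (0 < k)%N -> same_sign k ->
  exists r0 : nat, (r0 < 4)%N /\ forall r, (r < 4)%N ->
    if r == r0 then (b3_approx (r + 4 * k) = 28 %[mod 32])%Z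
    else exists2 c : nat, c \in [:: 4; 12; 20]%N &
         (b3_approx (r + 4 * k) = c %[mod 32])%Z.
Proof.
move=> k0 /eqP sk.
have E r : (r < 4)%N -> _ := @b3_approx_block k r k0.
rewrite sk in E; move: E.
have -> : odd k.-1 = ~~ odd k by case: (k) k0 => //= j _; rewrite negbK.
generalize (thue_morse k) (digit_twist k.-1) (digit_twist k) (odd k) => t c0 c1 o E.
have [r0 r04 H] : exists2 r0 : nat, (r0 < 4)%N & forall r, (r < 4)%N ->
    let x0 := (t, c0, ~~ o) in let x1 := (t, c1, o) in
    let v := ((quad_sum_at 4 x0 x1 (r + 4) - 4 * quad_sum_at 4 x0 x1 (r + 3)
      + 6 * quad_sum_at 4 x0 x1 (r + 2) - 4 * quad_sum_at 4 x0 x1 (r + 1)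
      + quad_sum_at 4 x0 x1 r) %% 32)%Z in
    if r == r0 then v == 28 else (v == 4) || (v == 12) || (v == 20).
  clear E sk; exists (find (fun r => let x0 := (t, c0, ~~ o) in let x1 := (t, c1, o) in
     ((quad_sum_at 4 x0 x1 (r + 4) - 4 * quad_sum_at 4 x0 x1 (r + 3)
      + 6 * quad_sum_at 4 x0 x1 (r + 2) - 4 * quad_sum_at 4 x0 x1 (r + 1)
      + quad_sum_at 4 x0 x1 r) %% 32)%Z == 28) (iota 0 4)).
    by move: t c0 c1 o; do 4! case; vm_compute.
  by case=> [|[|[|[|//]]]] _; move: t c0 c1 o; do 4! case; vm_compute.
exists r0; split=> // r r4; rewrite E //; move: (H r r4) => /=.
case: ifP => _; first by move/eqP.
by case/orP=> [/orP[]|] /eqP ->; [exists 4%N|exists 12%N|exists 20%N].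
Qed.

Lemma b3_approx_not_same_sign k r : (0 < k)%N -> ~~ same_sign k -> (r < 4)%N ->
  (b3_approx (r + 4 * k) = 2 %[mod 4])%Z.
Proof.
move=> k0 /negbTE sk r4; rewrite b3_approx_block //.
have {sk} -> : thue_morse k.-1 = ~~ thue_morse k.
  by move: sk; rewrite /same_sign; case: thue_morse; case: thue_morse.
have -> : odd k.-1 = ~~ odd k by case: (k) k0 => //= j _; rewrite negbK.
generalize (thue_morse k) (digit_twist k.-1) (digit_twist k) (odd k).
by case: r r4 => [|[|[|[|//]]]] _; do 4! case; vm_compute.
Qed.

Lemma same_sign_odd k : same_sign k.*2.+1 = false.
Proof.
have := thue_morse_double true k; have := thue_morse_double false k.
by rewrite /same_sign add0n add1n /= => -> ->; case: thue_morse.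
Qed.

(** [k.*2.-1] is [k.-1] with a digit 1 appended, which flips its Thue-Morse bit, while [k.*2] keeps
    that of [k]. *)
Lemma same_sign_double k : (0 < k)%N -> same_sign k.*2 = ~~ same_sign k.
Proof.
case: k => // k _; rewrite /same_sign doubleS /=.
have := thue_morse_double true k; have := thue_morse_double false k.+1.
by rewrite add0n doubleS add1n /= => -> ->; case: thue_morse; case: thue_morse.
Qed.

(** * Generating polynomials and the recurrence for [b 3] *)

Definition geom_poly (N j : nat) : {poly int} := \sum_(k < N.+1) 'X^(k * 2 ^ j).

Definition binary_poly (N : nat) : {poly int} := \prod_(j < N.+1) geom_poly N j.

(** Expanding the product means choosing a monomial for each color and each [j]; these choices are
    the multiplicity functions counted by [b]. *)
Lemma coef_binary_poly_diag m n : ((binary_poly n) ^+ m)`_n = (b m n)%:Z.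
Proof.
have -> : binary_poly n ^+ m =
    \prod_(p : 'I_m * 'I_n.+1) \sum_(k : 'I_n.+1) 'X^(k * 2 ^ p.2).
  rewrite -(pair_bigA _ (fun (_ : 'I_m) (j : 'I_n.+1) => geom_poly n j)) /=.
  by rewrite prodr_const card_ord.
rewrite bigA_distr_bigA /= coef_sum /b -sum1_card -natz natr_sum [RHS]big_mkcond /=.
apply: eq_bigr => f _; rewrite -expr_sum coefXn inE eq_sym.
by case: eqP.
Qed.

(** Congruence modulo ['X^N], by which truncated polynomials stand in for power series. *)
Definition eqpX (N : nat) (p q : {poly int}) := exists r, p = q + 'X^N * r.

Lemma eqpX_refl N p : eqpX N p p.
Proof. by exists 0; rewrite mulr0 addr0. Qed.

Lemma eqpX_sym N p q : eqpX N p q -> eqpX N q p.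
Proof. by case=> r ->; exists (- r); ring. Qed.

Lemma eqpX_trans N p q s : eqpX N p q -> eqpX N q s -> eqpX N p s.
Proof. by case=> r -> [t ->]; exists (r + t); ring. Qed.

Lemma eqpX_mul N p q p' q' : eqpX N p q -> eqpX N p' q' -> eqpX N (p * p') (q * q').
Proof.
by case=> r -> [t ->]; exists (r * q' + t * q + 'X^N * r * t); ring.
Qed.

Lemma eqpX_exp N p q m : eqpX N p q -> eqpX N (p ^+ m) (q ^+ m).
Proof.
move=> pq; elim: m => [|m IH]; first by rewrite !expr0; apply: eqpX_refl.
by rewrite !exprS; apply: eqpX_mul.
Qed.

Lemma eqpX_prod N m (F G : nat -> {poly int}) :
  (forall j, eqpX N (F j) (G j)) -> eqpX N (\prod_(j < m) F j) (\prod_(j < m) G j).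
Proof.
move=> FG; elim: m => [|m IH]; first by rewrite !big_ord0; apply: eqpX_refl.
by rewrite !big_ord_recr /=; apply: eqpX_mul.
Qed.

Lemma coef_eqpX N p q i : (i < N)%N -> eqpX N p q -> p`_i = q`_i.
Proof. by move=> iN [r ->]; rewrite coefD coefXnM iN addr0. Qed.

Lemma eqpX_geom1 N j : (N < 2 ^ j)%N -> eqpX N.+1 (geom_poly N j) 1.
Proof.
move=> Nj; rewrite /geom_poly big_ord_recl mul0n expr0.
have [r Hr] : exists r, \sum_(i < N) ('X^(lift ord0 i * 2 ^ j) : {poly int}) = 'X^(N.+1) * r.
  elim/big_rec: _ => [|i p _ [r ->]]; first by exists 0; rewrite mulr0.
  exists ('X^(bump 0 i * 2 ^ j - N.+1) + r); rewrite mulrDr -exprD subnKC //.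
  by rewrite /bump leq0n add1n mulSn; lia.
by rewrite Hr; exists r.
Qed.

Lemma eqpX_geomS N j : eqpX N.+1 (geom_poly N.+1 j) (geom_poly N j).
Proof.
rewrite /geom_poly big_ord_recr /=; exists ('X^(N.+1 * 2 ^ j - N.+1)).
by rewrite -exprD subnKC // leq_pmulr // expn_gt0.
Qed.

Lemma eqpX_binaryS N : eqpX N.+1 (binary_poly N.+1) (binary_poly N).
Proof.
rewrite /binary_poly big_ord_recr /= -[X in eqpX _ _ X]mulr1.
apply: eqpX_mul; first by apply: eqpX_prod => j; apply: eqpX_geomS.
apply: eqpX_trans (eqpX_geomS _ _) _; apply: eqpX_geom1.
exact: leq_trans (ltn_expl _ (ltnSn 1)).
Qed.

Lemma coef_binary_poly m n N : (n <= N)%N -> ((binary_poly N) ^+ m)`_n = (b m n)%:Z.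
Proof.
move/subnK <-; elim: (N - n)%N => [|k IH]; first exact: coef_binary_poly_diag.
by rewrite addSn -IH; apply/coef_eqpX/eqpX_exp/eqpX_binaryS; lia.
Qed.

(** Substituting x^2 shifts the factors 1 / (1 - x^(2^j)) by one index; only the factor with j = 0
    is lost, and 1 - x cancels it. *)
Lemma binary_poly_square N : eqpX N.+1 ((1 - 'X) * binary_poly N) (binary_poly N \Po 'X^2).
Proof.
have geom_comp j : geom_poly N j \Po 'X^2 = geom_poly N j.+1.
  rewrite /geom_poly rmorph_sum /=; apply: eq_bigr => k _.
  by rewrite comp_Xn_poly -exprM expnS mulnCA.
have -> : binary_poly N \Po 'X^2 = \prod_(j < N.+1) geom_poly N j.+1.
  by rewrite /binary_poly rmorph_prod; apply: eq_bigr => j _; apply: geom_comp.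
have -> : binary_poly N = geom_poly N 0 * \prod_(j < N) geom_poly N j.+1.
  by rewrite /binary_poly big_ord_recl; congr (_ * _); apply: eq_bigr.
rewrite [X in eqpX _ X _]mulrA.
rewrite big_ord_recr /= -[X in eqpX _ X _]mulrC.
apply: eqpX_mul.
  exact: eqpX_refl.
(* The surplus factor [geom_poly N N.+1] and the product of 1 - x with [geom_poly N 0] are both 1
   modulo ['X^N.+1]. *)
apply: eqpX_trans (eqpX_sym _ _ _ (eqpX_geom1 _ _ _)); last first.
  by rewrite (leq_trans _ (ltn_expl N.+1 (ltnSn 1))).
exists (-1); rewrite /geom_poly (eq_bigr (fun k : 'I_N.+1 => 'X^k)).
  have H : 1 - 'X^(N.+1) = (1 - 'X) * \sum_(k < N.+1) 'X^k :> {poly int}.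
    have := subrXX (1 : {poly int}) 'X N.+1; rewrite expr1n => ->.
    by congr (_ * _); apply: eq_bigr => k _; rewrite expr1n mul1r.
  by rewrite -H; ring.
by move=> k _; rewrite expn0 muln1.
Qed.

(** The coefficient of x^n in the cube of [binary_poly_square]; the conditionals replace terms of
    negative index by 0. *)
Lemma b3_rec n :
  (b 3 n)%:Z - 3 * (if (n < 1)%N then 0 else (b 3 (n - 1))%:Z)
  + 3 * (if (n < 2)%N then 0 else (b 3 (n - 2))%:Z)
  - (if (n < 3)%N then 0 else (b 3 (n - 3))%:Z)
  = if odd n then 0 else (b 3 n./2)%:Z.
Proof.
have := eqpX_exp _ _ _ 3 (binary_poly_square n); rewrite -rmorphXn.
move=> /(coef_eqpX _ _ _ _ (ltnSn n)); rewrite coef_comp_poly_Xn // exprMn.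
have -> : (1 - 'X) ^+ 3 * binary_poly n ^+ 3 = binary_poly n ^+ 3
  - ('X^1 * binary_poly n ^+ 3) *+ 3 + ('X^2 * binary_poly n ^+ 3) *+ 3
  - 'X^3 * binary_poly n ^+ 3.
  by ring.
rewrite !(coefB, coefD, coefMn); rewrite !coefXnM !coef_binary_poly ?leq_subr //; last first.
  by rewrite leq_div.
by rewrite dvdn2 divn2 if_neg !(mulr_natl _ 3).
Qed.

Lemma b3_0 : b 3 0 = 1%N.
Proof.
have := coef_binary_poly_diag 3 0; rewrite /binary_poly /geom_poly.
by rewrite !big_ord_recl !big_ord0 mul0n expr0 addr0 mulr1 expr1n coef1 => -[].
Qed.

Lemma b3_small : [/\ b 3 1 = 3, b 3 2 = 9 & b 3 3 = 19]%N.
Proof.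
have := b3_rec 1; have := b3_rec 2; have := b3_rec 3.
by rewrite /= !subnn !subn1 !subn2 /= b3_0; split; lia.
Qed.

(** From 8 on both sequences obey the same recurrence, by [b3_rec] and [b3_approx_step]; below 8 the
    values are computed. *)
Lemma b3_modE n : ((b 3 n)%:Z = b3_approx n %[mod 32])%Z.
Proof.
elim/ltn_ind: n => n IH; have [n8|n8] := ltnP n 8.
  have [b1 b2 b3] := b3_small.
  have rec4 m : (4 <= m)%N -> (b 3 m)%:Z - 3 * (b 3 m.-1)%:Z + 3 * (b 3 m.-2)%:Z
      - (b 3 m.-2.-1)%:Z = if odd m then 0 else (b 3 m./2)%:Z.
    by case: m => [|[|[|[|m]]]] //= _; have := b3_rec m.+4; rewrite !subSS !subn0 /=.
  have /= e4 := rec4 4%N isT; have /= e5 := rec4 5%N isT.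
  have /= e6 := rec4 6%N isT; have /= e7 := rec4 7%N isT.
  have b4 : b 3 4 = 42%N by clear -e4 b1 b2 b3; lia.
  have b5 : b 3 5 = 78%N by clear -b1 b2 b3 b4 e5; lia.
  have b6 : b 3 6 = 146%N by clear -b1 b2 b3 b4 b5 e6; lia.
  have b7 : b 3 7 = 246%N by clear -b1 b2 b3 b4 b5 b6 e7; lia.
  by case: n n8 {IH} => [|[|[|[|[|[|[|[|//]]]]]]]] _;
     rewrite ?(b1, b2, b3, b4, b5, b6, b7, b3_0).
rewrite b3_approx_step //; have := b3_rec n.
have n2 : (n./2 < n)%N by have := odd_double_half n; lia.
have := IH (n - 1)%N ltac:(lia); have := IH (n - 2)%N ltac:(lia).
have := IH (n - 3)%N ltac:(lia); have := IH _ n2.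
have -> : (n < 1)%N = false by lia.
have -> : (n < 2)%N = false by lia.
have -> : (n < 3)%N = false by lia.
by clear IH; case: (odd n); lia.
Qed.

Lemma b3_same_sign k : (0 < k)%N -> same_sign k ->
  exists r0 : nat, (r0 < 4)%N /\ forall r, (r < 4)%N ->
    if r == r0 then (b 3 (r + 4 * k) %% 32 = 28)%N
    else (b 3 (r + 4 * k) %% 32 \in [:: 4; 12; 20])%N.
Proof.
move=> k0 /(b3_approx_same_sign k k0) [r0 [r04 H]]; exists r0; split=> // r r4.
have := H r r4; case: ifP => _; rewrite -b3_modE; first by lia.
by case=> c; rewrite !inE => /or3P[] /eqP -> {H}; lia.
Qed.

Lemma b3_not_same_sign k r : (0 < k)%N -> ~~ same_sign k -> (r < 4)%N ->
  (b 3 (r + 4 * k) %% 4 = 2)%N.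
Proof.
move=> k0 sk r4; have := b3_approx_not_same_sign k r k0 sk r4.
by have := b3_modE (r + 4 * k); lia.
Qed.

(** * From rational to integral representations *)

Lemma near_multiple (x t : int) : 0 < t -> exists y : int, 4 * (x - t * y) ^+ 2 <= t ^+ 2.
Proof.
(* The floor of x / t + 1 / 2, an integer nearest to x / t. *)
move=> t0; exists ((2 * x + t) %/ (2 * t))%Z.
set y := ((2 * x + t) %/ (2 * t))%Z.
have d0 : 2 * t != 0 by lia.
have := divz_eq (2 * x + t) (2 * t); rewrite -/y.
have := modz_ge0 (2 * x + t) d0; have := @ltz_pmod (2 * x + t) (2 * t) ltac:(lia).
move: (_ %% _)%Z => m m1 m0 Em.
rewrite -subr_ge0.
have -> : t ^+ 2 - 4 * (x - t * y) ^+ 2 =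
  (t - 2 * (x - t * y)) * (t + 2 * (x - t * y)) by ring.
by apply: mulr_ge0; nia.
Qed.

(* Davenport-Cassels: reflecting the rational point x / t in the nearest integer
   point y gives a rational point with denominator t' = |t y - x|^2 / t < t. *)
Lemma three_squares_of_rational (n t x y z : int) : t != 0 ->
  n * t ^+ 2 = x ^+ 2 + y ^+ 2 + z ^+ 2 ->
  exists u v w : int, n = u ^+ 2 + v ^+ 2 + w ^+ 2.
Proof.
move=> t0 E.
have {E} : n * (`|t|%N : int) ^+ 2 = x ^+ 2 + y ^+ 2 + z ^+ 2.
  by rewrite -E abszE real_normK // num_real.
have {t0} : (0 < `|t|)%N by rewrite absz_gt0.
elim/ltn_ind: `|t|%N x y z => {}t IH x y z t0 E.
have tZ0 : 0 < t%:Z by rewrite ltz_nat.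
have [u Hu] := near_multiple x t%:Z tZ0.
have [v Hv] := near_multiple y t%:Z tZ0.
have [w Hw] := near_multiple z t%:Z tZ0.
(* The line through the rational point and (u, v, w) meets the sphere again at (a x + b u) / T and
   so on, so that [T] is the new denominator. *)
set a := u ^+ 2 + v ^+ 2 + w ^+ 2 - n.
set b := 2 * (n * t%:Z - (x * u + y * v + z * w)).
set T := a * t%:Z + b.
have tT : t%:Z * T = (x - t%:Z * u) ^+ 2 + (y - t%:Z * v) ^+ 2 + (z - t%:Z * w) ^+ 2.
  have -> : t%:Z * T = t%:Z ^+ 2 * (u ^+ 2 + v ^+ 2 + w ^+ 2) +
    n * t%:Z ^+ 2 - 2 * t%:Z * (x * u + y * v + z * w) by rewrite /T /a /b; ring.
  by rewrite E; ring.
have tT0 : 0 <= t%:Z * T by rewrite tT !addr_ge0 ?sqr_ge0.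
have T0 : 0 <= T by rewrite pmulr_rge0 in tT0.
(* Each of the three squares is at most t^2 / 4, so t T <= 3 t^2 / 4. *)
have Tt : T < t%:Z.
  rewrite -(ltr_pM2l tZ0) tT.
  have : 0 < t%:Z ^+ 2 by rewrite exprn_gt0.
  by rewrite -expr2; lra.
have [Tz|Tz] := eqVneq T 0.
  exists u, v, w; have := tT; rewrite Tz mulr0 => /esym/eqP.
  rewrite !paddr_eq0 ?addr_ge0 ?sqr_ge0 // !sqrf_eq0 !subr_eq0.
  move=> /andP[/andP[/eqP xu /eqP yv] /eqP zw].
  apply: (mulIf (_ : t%:Z ^+ 2 != 0)); first by rewrite sqrf_eq0; lia.
  by rewrite E xu yv zw; ring.
have Tn : `|T|%N%:Z = T by rewrite gez0_abs.
apply: (IH `|T|%N _ (a * x + b * u) (a * y + b * v) (a * z + b * w)).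
- by rewrite -ltz_nat Tn.
- by rewrite absz_gt0.
rewrite Tn.
have -> : (a * x + b * u) ^+ 2 + (a * y + b * v) ^+ 2 + (a * z + b * w) ^+ 2 =
  a ^+ 2 * (x ^+ 2 + y ^+ 2 + z ^+ 2) + 2 * a * b * (x * u + y * v + z * w)
  + b ^+ 2 * (n + a) by rewrite /a; ring.
have -> : 2 * a * b * (x * u + y * v + z * w) = a * b * (2 * n * t%:Z - b).
  by rewrite /b; ring.
by rewrite -E /T; ring.
Qed.

(** Provides the sides of the pigeonhole box: c^2 >= N makes it large enough, while differences of
    coordinates have squares at most (c - 1)^2 < N. *)
Lemma ceil_sqrt (N : nat) : (0 < N)%N -> exists2 c : nat, (0 < c)%N &
  (c.-1 ^ 2 < N <= c ^ 2)%N.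
Proof.
move=> N0; have ex : exists c, (N <= c ^ 2)%N by exists N; rewrite leq_pmulr.
have [c cN minc] := ex_minnP ex; exists c; first by case: c cN {minc} => //; lia.
rewrite cN andbT ltnNge; apply/negP => /minc.
by case: c cN {minc} => [|c] /=; lia.
Qed.

Lemma inord_modz_eq (m : nat) (a c : int) : (0 < m)%N ->
  (inord `|(a %% m%:Z)%Z|%N : 'I_m.-1.+1) = inord `|(c %% m%:Z)%Z|%N ->
  (m%:Z %| a - c)%Z.
Proof.
move=> m0; have mZ : m%:Z != 0 by lia.
have lt_m x : (`|(x %% m%:Z)%Z|%N < m.-1.+1)%N.
  by rewrite prednK // -ltz_nat gez0_abs ?modz_ge0 // ltz_pmod.
move/(congr1 val); rewrite /= !inordK // => /(congr1 Posz).
by rewrite !gez0_abs ?modz_ge0 // -eqz_mod_dvd => /eqP.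
Qed.

Lemma sqr_ord_diff_le (c : nat) (i j : 'I_c) :
  (i%:Z - j%:Z) ^+ 2 <= (c.-1 ^ 2)%N%:Z.
Proof.
have : `|i%:Z - j%:Z| <= c.-1%:Z by have := ltn_ord i; have := ltn_ord j; lia.
by rewrite -real_normK ?num_real // expnS expn1 PoszM -expr2 => h; apply: lerXn2r; rewrite ?nnegrE.
Qed.

(* Pigeonhole: V = z^2 + Q w^2 - n t^2 is a multiple of n Q in (- n Q, 2 n Q). If
   V = n Q, then n (t^2 + Q)^2 = (z t - Q w)^2 + Q (z + t w)^2. *)
Lemma legendre_equation (n Q : nat) (r s : int) : (0 < n)%N -> (0 < Q)%N ->
  coprime n Q -> (Q%:Z %| s ^+ 2 - n%:Z)%Z -> (n%:Z %| r ^+ 2 + Q%:Z)%Z ->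
  exists z w t : int, t != 0 /\ n%:Z * t ^+ 2 = z ^+ 2 + Q%:Z * w ^+ 2.
Proof.
move=> n0 Q0 cop Hs Hr.
(* The sides are about sqrt(n Q), sqrt Q and sqrt(n + 1). Taking n + 1 makes the number of points
   exceed n Q and still yields w^2 <= n. *)
have [cz cz0 /andP[cz1 cz2]] := @ceil_sqrt (n * Q) ltac:(by rewrite muln_gt0 n0).
have [ct ct0 /andP[ct1 ct2]] := @ceil_sqrt Q Q0.
have [cw cw0 /andP[cw1 cw2]] := @ceil_sqrt n.+1 isT.
pose f (x : 'I_cz * 'I_cw * 'I_ct) : 'I_Q.-1.+1 * 'I_n.-1.+1 :=
  let: (z, w, t) := x in
  (inord (absz ((z%:Z - s * t%:Z) %% Q%:Z)%Z), inord (absz ((z%:Z - r * w%:Z) %% n%:Z)%Z)).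
have [] : exists x, exists2 y, x != y & f x = f y.
  apply/injectivePn/negP => /injectiveP /leq_card.
  rewrite !card_prod !card_ord !prednK // leqNgt => /negP; apply.
  rewrite -ltn_sqr; apply: (@leq_trans ((n * Q) * n.+1 * Q)); last first.
    by rewrite !expnMn; do 2! [apply: leq_mul => //].
  by rewrite (mulnC Q) expnS expn1 -!mulnA !ltn_pmul2l ?ltn_pmul2r ?muln_gt0 ?n0 ?Q0.
move=> [[z1 w1] t1] [[[z2 w2] t2]] ne [].
move=> /(inord_modz_eq _ _ _ Q0) eQ /(inord_modz_eq _ _ _ n0) en.
pose z := z1%:Z - z2%:Z; pose w := w1%:Z - w2%:Z; pose t := t1%:Z - t2%:Z.
have zwt : ~~ [&& z == 0, w == 0 & t == 0].
  apply: contra ne; rewrite /z /w /t !subr_eq0 !eqz_nat.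
  by case/and3P=> /eqP/val_inj -> /eqP/val_inj -> /eqP/val_inj ->.
have z_le : z ^+ 2 < (n * Q)%N%:Z by apply: le_lt_trans (sqr_ord_diff_le _ _ _) _; rewrite ltz_nat.
have t_le : t ^+ 2 < Q%:Z by apply: le_lt_trans (sqr_ord_diff_le _ _ _) _; rewrite ltz_nat.
have w_le : w ^+ 2 <= n%:Z.
  by apply: le_trans (sqr_ord_diff_le _ _ _) _; rewrite lez_nat -ltnS.
have {}eQ : (Q%:Z %| z - s * t)%Z by move: eQ; congr (_ %| _)%Z; rewrite /z /t; ring.
have {}en : (n%:Z %| z - r * w)%Z by move: en; congr (_ %| _)%Z; rewrite /z /w; ring.
clearbody z w t.

have [k Hk] : exists k, z ^+ 2 + Q%:Z * w ^+ 2 - n%:Z * t ^+ 2 = k * (n%:Z * Q%:Z).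
  apply/dvdzP; rewrite Gauss_dvdz //; apply/andP; split.
    have -> : z ^+ 2 + Q%:Z * w ^+ 2 - n%:Z * t ^+ 2 =
      (z - r * w) * (z + r * w) + (r ^+ 2 + Q%:Z) * w ^+ 2 + n%:Z * (- t ^+ 2) by ring.
    by rewrite !rpredD // dvdz_mulr.
  have -> : z ^+ 2 + Q%:Z * w ^+ 2 - n%:Z * t ^+ 2 =
    (z - s * t) * (z + s * t) + (s ^+ 2 - n%:Z) * t ^+ 2 + Q%:Z * w ^+ 2 by ring.
  by rewrite !rpredD // dvdz_mulr.
have nZ : 0 < n%:Z by rewrite ltz_nat.
have QZ : 0 < Q%:Z by rewrite ltz_nat.
have k01 : k = 0 \/ k = 1.
  have Qw : Q%:Z * w ^+ 2 <= n%:Z * Q%:Z by rewrite mulrC ler_pM2r.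
  have nt : n%:Z * t ^+ 2 < n%:Z * Q%:Z by rewrite ltr_pM2l.
  have w0 := sqr_ge0 w; have z0 := sqr_ge0 z; have t_ge0 := sqr_ge0 t.
  have Qw0 : 0 <= Q%:Z * w ^+ 2 by rewrite mulr_ge0 // ltW.
  have nt0 : 0 <= n%:Z * t ^+ 2 by rewrite mulr_ge0 // ltW.
  have nQ0 : 0 < n%:Z * Q%:Z by rewrite mulr_gt0.
  have k2 : k < 2 by rewrite -(ltr_pM2r nQ0) -Hk; move: z_le; rewrite PoszM; lra.
  have k1 : -1 < k by rewrite -(ltr_pM2r nQ0) -Hk; lra.
  by clear -k1 k2; lia.
case: k01 Hk => ->; rewrite ?mul0r ?mul1r => Hk.
  exists z, w, t; split; last by apply/eqP; rewrite -subr_eq0 -oppr_eq0 -Hk; apply/eqP; ring.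
  apply: contra zwt => /eqP t0; move/eqP: Hk; rewrite t0 expr0n mulr0 subr0.
  have Qw0 : 0 <= Q%:Z * w ^+ 2 by rewrite mulr_ge0 ?sqr_ge0 // ltW.
  rewrite paddr_eq0 ?sqr_ge0 // sqrf_eq0 mulf_eq0 sqrf_eq0.
  by rewrite (gt_eqF QZ) /= eqxx andbT.
exists (z * t - Q%:Z * w), (z + t * w), (t ^+ 2 + Q%:Z); split.
  by rewrite gt_eqF // ltr_wpDl ?sqr_ge0.
have {}Hk : z ^+ 2 = n%:Z * Q%:Z + n%:Z * t ^+ 2 - Q%:Z * w ^+ 2 by rewrite -Hk; ring.
have -> : (z * t - Q%:Z * w) ^+ 2 + Q%:Z * (z + t * w) ^+ 2 =
  (z ^+ 2 + Q%:Z * w ^+ 2) * (t ^+ 2 + Q%:Z) by ring.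
by rewrite Hk; ring.
Qed.

Lemma prime_two_squares (q : nat) (r : int) : (0 < q)%N -> (q%:Z %| r ^+ 2 + 1)%Z ->
  exists u v t : int, t != 0 /\ q%:Z * t ^+ 2 = u ^+ 2 + v ^+ 2.
Proof.
move=> q0 Hr; have [u [v [t [t0 E]]]] :=
  @legendre_equation q 1 r 0 q0 isT (coprimen1 q) (dvd1z _) Hr.
by exists u, v, t; split=> //; rewrite E mul1r.
Qed.

(** Since Q is a sum of two rational squares, so is Q w^2, and the solution of the Legendre equation
    represents n by three rational squares. *)
Lemma three_squares_of_legendre (n Q : nat) (r s u v t : int) :
  (0 < n)%N -> (0 < Q)%N -> coprime n Q ->
  (Q%:Z %| s ^+ 2 - n%:Z)%Z -> (n%:Z %| r ^+ 2 + Q%:Z)%Z ->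
  t != 0 -> Q%:Z * t ^+ 2 = u ^+ 2 + v ^+ 2 ->
  exists x y z : int, n%:Z = x ^+ 2 + y ^+ 2 + z ^+ 2.
Proof.
move=> n0 Q0 cop Hs Hr t0 E.
have [z [w [m [m0 Em]]]] := legendre_equation n Q r s n0 Q0 cop Hs Hr.
apply: (three_squares_of_rational n (m * t) (z * t) (w * u) (w * v)).
  by rewrite mulf_neq0.
have -> : n%:Z * (m * t) ^+ 2 = (n%:Z * m ^+ 2) * t ^+ 2 by ring.
have -> : n%:Z * m ^+ 2 * t ^+ 2 = z ^+ 2 * t ^+ 2 + (Q%:Z * t ^+ 2) * w ^+ 2.
  by rewrite Em; ring.
by rewrite E; ring.
Qed.

(** * Legendre symbols and quadratic reciprocity *)

(** Euler's criterion serves as the definition, which makes multiplicativity easy; that elements of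
    value 1 are squares is [quad_char_sqr]. *)
Definition quad_char (p : nat) (x : 'F_p) : int :=
  if x == 0 then 0 else if x ^+ p.-1./2 == 1 then 1 else -1.

Definition legendre (p a : nat) : int := quad_char p a%:R.

Lemma prod_evens (R : comNzRingType) n :
  \prod_(1 <= k < n.*2.+1) (if odd k then 1 else k%:R : R) = 2%:R ^+ n * n`!%:R.
Proof.
elim: n => [|n IH]; first by rewrite big_geq // mulr1.
rewrite doubleS big_nat_recr //= [X in X * _]big_nat_recr //= IH odd_double /= mulr1.
by rewrite -doubleS -mul2n factS !natrM exprS; ring.
Qed.

(* Even numbers above n are traded for odd numbers below n by k -> - k. *)
Lemma prod_evens_sign (R : comNzRingType) n : n.*2.+1%:R = 0 :> R ->
  \prod_(1 <= k < n.*2.+1) (if odd k then 1 else k%:R : R) = (-1) ^+ uphalf n * n`!%:R.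
Proof.
move=> n0; rewrite (@big_cat_nat _ _ _ n.+1) //=; last by lia.
rewrite [X in _ * X]big_nat_rev /= -{2}[n.+1]add1n big_addn.
have -> : (n.*2.+1 - n = n.+1)%N by lia.
rewrite -big_split /=.
rewrite (eq_big_nat _ _ (F2 := fun k => (-1) ^+ odd k * k%:R)) => [|k /andP[k1 kn]].
  elim: n {n0} => [|n IH]; first by rewrite big_geq // mulr1.
  rewrite big_nat_recr //= IH factS natrM uphalf_half exprD.
  by rewrite exprS; case: (odd n); rewrite ?expr0 ?expr1; ring.
have -> : (1 + n + n.*2.+1 - (k + n).+1 = n.*2.+1 - k)%N by lia.
rewrite oddB; last by lia.
rewrite natrB ?n0 /= ?odd_double; last by lia.
by case: (odd k) => /=; ring.
Qed.

Section QuadraticCharacter.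
Context {p : nat} (p_pr : prime p) (p_gt2 : (2 < p)%N).
Local Notation h := p.-1./2.

Lemma prime_gt2_odd : odd p.
Proof. by case: (even_prime p_pr) => // p2; move: (p_gt2); rewrite p2. Qed.

Lemma pred_prime_half : p.-1 = h.*2.
Proof. by have := odd_double_half p; rewrite prime_gt2_odd; lia. Qed.

Lemma Fp_one_neqN1 : (1 : 'F_p) != -1.
Proof.
rewrite -subr_eq0 opprK -[1 + 1](natrD _ 1 1) -(dvdn_pcharf (pchar_Fp p_pr)).
by rewrite gtnNdvd.
Qed.

Lemma Fp_fermat (x : 'F_p) : x != 0 -> x ^+ p.-1 = 1.
Proof.
move=> x0; apply: (mulfI x0); rewrite mulr1 -exprS prednK ?prime_gt0 //.
by have := expf_card x; rewrite card_Fp.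
Qed.

Lemma quad_char_expE (x : 'F_p) : (quad_char p x)%:~R = x ^+ h.
Proof.
rewrite /quad_char; case: eqVneq => [->|x0].
  by rewrite expr0n; case: eqP => // h0; move: pred_prime_half p_gt2; rewrite h0; lia.
case: eqVneq => [->|x1] //; have : x ^+ h ^+ 2 == 1.
  by rewrite -exprM muln2 -pred_prime_half Fp_fermat.
by rewrite sqrf_eq1 (negbTE x1) => /eqP ->; rewrite rmorphN1.
Qed.

(** Allows identities between symbols to be verified in ['F_p], where the symbol is a power. *)
Lemma quad_char_inj (e f : int) : e \in [:: 0; 1; -1] -> f \in [:: 0; 1; -1] ->
  (e%:~R : 'F_p) = f%:~R -> e = f.
Proof.
have n1 := Fp_one_neqN1; have n0 : (1 : 'F_p) != 0 := oner_neq0 _.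
have n0' : (-1 : 'F_p) != 0 by rewrite oppr_eq0.
rewrite !inE => /or3P[] /eqP -> /or3P[] /eqP -> //; rewrite ?rmorphN1 ?rmorph0 ?rmorph1 => /eqP;
  by rewrite ?(negbTE n1) ?(negbTE n0) ?(negbTE n0') // eq_sym
    ?(negbTE n1) ?(negbTE n0) ?(negbTE n0').
Qed.

Lemma quad_char_range (x : 'F_p) : quad_char p x \in [:: 0; 1; -1].
Proof. by rewrite /quad_char; case: ifP => // _; case: ifP. Qed.

Lemma quad_charM (x y : 'F_p) : quad_char p (x * y) = quad_char p x * quad_char p y.
Proof.
apply: quad_char_inj; first exact: quad_char_range.
  have := quad_char_range x; have := quad_char_range y.
  by rewrite !inE => /or3P[] /eqP -> /or3P[] /eqP ->.
by rewrite rmorphM /= !quad_char_expE exprMn.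
Qed.

Lemma quad_char1 : quad_char p 1 = 1.
Proof. by rewrite /quad_char oner_eq0 expr1n eqxx. Qed.

Lemma quad_char_eq0 (x : 'F_p) : (quad_char p x == 0) = (x == 0).
Proof. by rewrite /quad_char; have [_|_] := eqVneq x 0; last case: ifP. Qed.

Lemma quad_charV (x : 'F_p) : x != 0 -> quad_char p x^-1 = quad_char p x.
Proof.
move=> x0; have := quad_charM x x^-1; rewrite divff // quad_char1.
by rewrite /quad_char invr_eq0 (negbTE x0); do 2! case: ifP.
Qed.

Lemma Fp_primitive_root : exists z : 'F_p, p.-1.-primitive_root z.
Proof.
have : has p.-1.-primitive_root [seq x <- enum 'F_p | x != 0].
  apply: has_prim_root; first by move: p_gt2; lia.
  - by apply/allP => x; rewrite mem_filter unity_rootE => /andP[/Fp_fermat -> _].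
  - by apply: filter_uniq; apply: enum_uniq.
  suff -> : size [seq x <- enum 'F_p | x != 0] = p.-1 by [].
  have := cardC1 (0 : 'F_p); rewrite card_Fp // => <-.
  have /card_uniqP <- : uniq [seq x <- enum 'F_p | x != 0].
    by apply: filter_uniq; apply: enum_uniq.
  by apply: eq_card => x; rewrite mem_filter mem_enum andbT.
by case/hasP => z _; exists z.
Qed.

(** For x = z^i with z a primitive root, x^h = 1 forces 2 h to divide i h, so i is even. *)
Lemma quad_char_sqr (x : 'F_p) : quad_char p x = 1 -> exists y, x = y ^+ 2.
Proof.
move=> x1; have [z prz] := Fp_primitive_root.
have x0 : x != 0 by rewrite -quad_char_eq0 x1.
have [[i _] /= xi] := prim_rootP prz (Fp_fermat x x0).
have : x ^+ h = 1 by rewrite -quad_char_expE x1.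
move=> /eqP; rewrite xi -exprM -(prim_order_dvd prz) {1}pred_prime_half -mul2n dvdn_pmul2r.
  by move=> /dvdnP[k ->]; exists (z ^+ k); rewrite -exprM.
by move: pred_prime_half p_gt2; lia.
Qed.

Lemma quad_char_nonresidue : exists x : 'F_p, quad_char p x = -1.
Proof.
have [z prz] := Fp_primitive_root; exists z; rewrite /quad_char.
have h0 : (0 < h)%N by move: pred_prime_half p_gt2; lia.
have p10 : (0 < p.-1)%N by lia.
rewrite ifF; last first.
  apply/eqP => z0; have := prim_expr_order prz; rewrite z0 expr0n.
  by rewrite (gtn_eqF p10) => /esym/eqP; rewrite oner_eq0.
rewrite -(prim_order_dvd prz) gtnNdvd //; first by move: pred_prime_half; lia.
Qed.

Lemma sum_quad_char : \sum_(x : 'F_p) quad_char p x = 0.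
Proof.
have [y Hy] := quad_char_nonresidue.
have y0 : y != 0 by rewrite -quad_char_eq0 Hy.
have : \sum_(x : 'F_p) quad_char p x = - \sum_(x : 'F_p) quad_char p x.
  rewrite {1}(reindex_onto (fun x => y * x) (fun x => y^-1 * x)) /=; last first.
    by move=> x _; rewrite mulVKf.
  rewrite -sumrN; apply: eq_big => [x|x _]; first by rewrite mulKf ?eqxx.
  by rewrite quad_charM Hy mulN1r.
by lia.
Qed.

Lemma legendreM a b : legendre p (a * b) = legendre p a * legendre p b.
Proof. by rewrite /legendre natrM quad_charM. Qed.

Lemma legendre_mod a : legendre p (a %% p) = legendre p a.
Proof. by rewrite /legendre Fp_nat_mod. Qed.

Lemma legendre_eq0 a : (legendre p a == 0) = (p %| a)%N.
Proof. by rewrite /legendre quad_char_eq0 (dvdn_pcharf (pchar_Fp p_pr)). Qed.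

Lemma legendre_range a : legendre p a \in [:: 0; 1; -1].
Proof. exact: quad_char_range. Qed.

Lemma legendre_expE a : ((legendre p a)%:~R : 'F_p) = a%:R ^+ h.
Proof. exact: quad_char_expE. Qed.

Lemma legendre_sqr a : legendre p a = 1 -> exists s : nat, s ^ 2 = a %[mod p].
Proof.
move=> /quad_char_sqr [y Hy]; exists y; apply/eqP.
by rewrite -!(val_Fp_nat p_pr) natrX natr_Zp Hy.
Qed.

Lemma legendre_nonresidue : exists a : nat, legendre p a = -1.
Proof.
by have [x Hx] := quad_char_nonresidue; exists x; rewrite /legendre natr_Zp.
Qed.

Lemma legendre_N1 : legendre p p.-1 = (-1) ^+ h.
Proof.
apply: quad_char_inj; first exact: quad_char_range.
  by rewrite -signr_odd; case: odd.
rewrite quad_char_expE -subn1 natrB ?prime_gt0 // pchar_Fp_0 // sub0r.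
by rewrite rmorphXn rmorphN1.
Qed.

(** The product of the even numbers below p is evaluated by [prod_evens] and by [prod_evens_sign];
    the common factor h! is invertible modulo p. *)
Lemma legendre_2 : legendre p 2 = (-1) ^+ uphalf h.
Proof.
have pE : p = h.*2.+1 by rewrite -pred_prime_half prednK ?prime_gt0.
have := prod_evens_sign 'F_p h; rewrite -pE => /(_ (pchar_Fp_0 p_pr)).
have := prod_evens 'F_p h; rewrite -pE => -> Esign.
apply: quad_char_inj; first exact: quad_char_range.
  by rewrite -signr_odd; case: odd.
rewrite quad_char_expE rmorphXn rmorphN1; apply: mulIf Esign.
rewrite -(dvdn_pcharf (pchar_Fp p_pr)).
suff H m : (m <= h)%N -> ~~ (p %| m`!)%N by apply: H.
elim: m => [|n IH] hn; first by rewrite dvdn1 gtn_eqF // prime_gt1.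
rewrite factS Euclid_dvdM // negb_or IH ?(ltnW hn) // andbT gtnNdvd //.
by move: pE hn; lia.
Qed.
End QuadraticCharacter.

(** Taken from a splitting field of 1 + X + ... + X^(q-1). The vanishing sum is the form needed for
    Gauss sums, and it implies z^q = 1. *)
Lemma exists_root_of_unity (p q : nat) : prime p -> (1 < q)%N ->
  exists (L : splittingFieldType 'F_p) (z : L), \sum_(i < q) z ^+ i = 0.
Proof.
move=> p_pr q1.
pose P : {poly 'F_p} := \poly_(i < q) 1.
have sP : size P = q by rewrite size_poly_eq ?oner_eq0.
have P0 : P != 0 by rewrite -size_poly_gt0 sP ltnW.
have [L [rs Hrs _]] := FinSplittingFieldFor P0.
exists L; case: rs Hrs => [|z rs] Hrs.
  by have := eqp_size Hrs; rewrite big_nil size_map_poly sP size_poly1 => q1'; rewrite q1' in q1.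
exists z; have : root (map_poly (in_alg L) P) z.
  by rewrite (eqp_root Hrs) big_cons rootM root_XsubC eqxx.
rewrite /root /P poly_def rmorph_sum horner_sum => /eqP E.
by rewrite -[RHS]E; apply: eq_bigr => i _; rewrite scale1r /= map_polyXn hornerXn.
Qed.

(** * Quadratic Gauss sums in characteristic [p] *)

Section Reciprocity.
Context {p q : nat} (p_pr : prime p) (q_pr : prime q) (p_gt2 : (2 < p)%N).
Context (q_gt2 : (2 < q)%N) (p_neq_q : p != q) (q_mod4 : (q %% 4 = 1)%N).
Context (L : splittingFieldType 'F_p) (z : L) (z_sum : \sum_(i < q) z ^+ i = 0).

Let e (x : 'F_q) : L := z ^+ x.
Let chi (x : 'F_q) : L := (quad_char q x)%:~R.
Let gauss_sum : L := \sum_x chi x * e x.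

Lemma root_of_unity_expq : z ^+ q = 1.
Proof.
have := subrXX 1 z q; rewrite expr1n.
have -> : \sum_(i < q) 1 ^+ (q.-1 - i) * z ^+ i = \sum_(i < q) z ^+ i.
  by apply: eq_bigr => i _; rewrite expr1n mul1r.
by rewrite z_sum mulr0 => /eqP; rewrite subr_eq0 => /eqP.
Qed.

Lemma add_charD x y : e (x + y) = e x * e y.
Proof.
rewrite /e -exprD -[in RHS](expr_mod _ root_of_unity_expq); congr (_ ^+ _).
by congr (_ %% _)%N; apply: Fp_cast.
Qed.

Lemma add_charMn x n : e (n%:R * x) = e x ^+ n.
Proof.
elim: n => [|n IH]; first by rewrite mul0r.
by rewrite -natr1 mulrDl mul1r add_charD IH exprSr.
Qed.

Lemma add_char_sum : \sum_x e x = 0.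
Proof.
rewrite -[RHS]z_sum -!(big_mkord xpredT (fun i => z ^+ i)).
by congr (\sum_(_ <= _ < _) _); apply: Fp_cast.
Qed.

Lemma add_char_sum_scaled c : \sum_x e (x * c) = if c == 0 then q%:R else 0.
Proof.
case: eqVneq => [->|c0].
  rewrite (eq_bigr (fun=> 1)) => [|x _]; last by rewrite mulr0.
  by rewrite sumr_const card_Fp.
rewrite -[RHS]add_char_sum [RHS](reindex_onto (fun x => x * c) (fun x => x / c)) /=.
  by apply: eq_bigl => x; rewrite mulfK ?eqxx.
by move=> x _; rewrite mulfVK.
Qed.

Lemma chi_mul x y : chi (x * y) = chi x * chi y.
Proof. by rewrite /chi quad_charM // rmorphM. Qed.

Lemma chi_N1 : chi (-1) = 1.
Proof.
have -> : (-1 : 'F_q) = q.-1%:R.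
  by rewrite -subn1 natrB ?prime_gt0 // pchar_Fp_0 // sub0r.
rewrite /chi -/(legendre q q.-1) legendre_N1 //.
have -> : q.-1./2 = (q %/ 4).*2 by lia.
by rewrite -signr_odd odd_double.
Qed.

(** Substituting y = x c in the double sum leaves inner sums over x != 0 of e(x (1 + c)), equal to q
    - 1 for c = -1 and to -1 otherwise. The constant -1 drops out as chi sums to 0, and chi(-1) = 1
    as q = 1 modulo 4. *)
Lemma gauss_sum_sqr : gauss_sum ^+ 2 = q%:R.
Proof.
have -> : gauss_sum ^+ 2 = \sum_c chi c * \sum_(x | x != 0) e (x * (1 + c)).
  rewrite expr2 {1}/gauss_sum mulr_suml (bigD1 0) //=.
  rewrite {1}/chi /quad_char eqxx rmorph0 !mul0r add0r.
  transitivity (\sum_(x | x != 0) \sum_c chi c * e (x * (1 + c))).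
    apply: eq_bigr => x x0; rewrite mulr_sumr.
    rewrite (reindex_onto (fun c => x * c) (fun y => x^-1 * y)) /=; last first.
      by move=> y _; rewrite mulVKf.
    apply: eq_big => [c|c _]; first by rewrite mulKf ?eqxx.
    rewrite chi_mul mulrDr mulr1 add_charD.
    have : chi x * chi x = 1.
      rewrite -rmorphM /=; have := quad_char_range x.
      have := quad_char_eq0 x; rewrite (negbTE x0) !inE.
      by move=> /negbT /negbTE -> /= /orP[] /eqP ->; rewrite ?mulr1 ?mulrNN.
    by move=> chi2; rewrite -[RHS]mul1r -chi2; ring.
  rewrite exchange_big; apply: eq_bigr => c _; by rewrite mulr_sumr.
have E c : \sum_(x | x != 0) e (x * (1 + c)) = (if c == -1 then q%:R else 0) - 1.
  have := add_char_sum_scaled (1 + c); rewrite (bigD1 0) //= mul0r.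
  have -> : (1 + c == 0) = (c == -1) by rewrite addrC addr_eq0.
  have -> : e 0 = 1 by rewrite /e expr0.
  by move=> <-; ring.
under eq_bigr do rewrite E mulrBr mulr1.
rewrite big_split /= sumrN (bigD1 (-1)) //= eqxx chi_N1 mul1r.
rewrite big1 ?addr0 => [|c /negbTE ->]; last by rewrite mulr0.
have -> : \sum_x chi x = 0 by rewrite /chi -rmorph_sum sum_quad_char ?rmorph0.
by rewrite subr0.
Qed.

Lemma pchar_splitting : p \in [pchar L].
Proof. by rewrite pchar_lalg pchar_Fp. Qed.

(** Frobenius is additive, fixes the values of chi and turns e(x) into e(p x); replacing x by x / p
    brings out chi(1 / p) = chi(p). *)
Lemma gauss_sum_frobenius : gauss_sum ^+ p = (legendre q p)%:~R * gauss_sum.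
Proof.
have chip x : chi x ^+ p = chi x.
  rewrite /chi; have p_odd := prime_gt2_odd p_pr p_gt2.
  have := quad_char_range x; rewrite !inE => /or3P[] /eqP ->.
  - by rewrite rmorph0 expr0n gtn_eqF ?prime_gt0.
  - by rewrite rmorph1 expr1n.
  - by rewrite rmorphN1 -signr_odd p_odd expr1.
have p0 : (p%:R : 'F_q) != 0.
  by rewrite -(dvdn_pcharf (pchar_Fp q_pr)) dvdn_prime2 // eq_sym.
rewrite -(pFrobenius_autE pchar_splitting) {1}/gauss_sum rmorph_sum /=.
rewrite /gauss_sum mulr_sumr.
rewrite (reindex_onto (fun x => p%:R^-1 * x) (fun x => p%:R * x)) /=; last first.
  by move=> x _; rewrite mulKf.
apply: eq_big => [x|x _]; first by rewrite mulVKf ?eqxx.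
rewrite rmorphM /= !pFrobenius_autE chip -add_charMn mulVKf // chi_mul mulrA.
by rewrite /chi quad_charV.
Qed.

(** The p-th power of the Gauss sum g is g times q^((p-1)/2), the symbol of q modulo p; by Frobenius
    it is also g times the symbol of p modulo q. *)
Lemma reciprocity_splitting : legendre p q = legendre q p.
Proof.
have q0 : (q%:R : L) != 0.
  by rewrite -(dvdn_pcharf pchar_splitting) dvdn_prime2.
have g0 : gauss_sum != 0 by rewrite -sqrf_eq0 gauss_sum_sqr.
apply: (quad_char_inj p_pr p_gt2); [exact: legendre_range..|].
rewrite legendre_expE //; apply: (fmorph_inj (in_alg L)).
rewrite rmorphXn rmorph_nat rmorph_int -gauss_sum_sqr -exprM mulnC muln2.
rewrite -pred_prime_half //; apply: (mulIf g0).
by rewrite -exprSr prednK ?prime_gt0 // gauss_sum_frobenius.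
Qed.
End Reciprocity.

Lemma quadratic_reciprocity (p q : nat) : prime p -> prime q -> (2 < p)%N ->
  (2 < q)%N -> p != q -> (q %% 4 = 1)%N -> legendre p q = legendre q p.
Proof.
move=> p_pr q_pr p2 q2 pq q4.
have [L [z z_sum]] := exists_root_of_unity p q p_pr (prime_gt1 q_pr).
exact: reciprocity_splitting z_sum.
Qed.

(** * Primes with prescribed values of real characters *)

Section FiniteSums.
Context {R : realType}.
Implicit Types (f g : nat -> R).

Lemma sum_multiples g d N : (0 < d)%N ->
  \sum_(1 <= k < N.+1 | (d %| k)%N) g (k %/ d)%N = \sum_(1 <= e < (N %/ d).+1) g e.
Proof.
move=> d0; elim: N => [|N IH]; first by rewrite div0n !big_geq.
rewrite big_mkcond big_nat_recr //= -big_mkcond /= IH divnS //.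
by case: (d %| N.+1)%N; rewrite ?addr0 // add1n [in RHS]big_nat_recr.
Qed.

(** Both sides run over the pairs of positive d and e with d e <= N. *)
Lemma sum_divisor_pairs (F : nat -> nat -> R) N :
  \sum_(1 <= k < N.+1) \sum_(1 <= d < N.+1 | (d %| k)%N) F d (k %/ d)%N =
  \sum_(1 <= d < N.+1) \sum_(1 <= e < (N %/ d).+1) F d e.
Proof.
under eq_bigr do rewrite big_mkcond.
rewrite exchange_big_nat /=; apply: eq_big_nat => d /andP[d0 _].
by rewrite -big_mkcond sum_multiples.
Qed.

Lemma abel_bound (u f : nat -> R) (B : R) a n :
  (forall c, (a <= c)%N -> `|\sum_(a <= k < c) u k| <= B) ->
  (forall k, (a <= k)%N -> 0 <= f k.+1 <= f k) -> 0 <= f a ->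
  `|\sum_(a <= k < n) u k * f k| <= B * f a.
Proof.
move=> HB Hf f0; have [na|an] := leqP n a.
  rewrite big_geq // normr0 mulr_ge0 //.
  by have := HB a (leqnn a); rewrite big_geq // normr0.
rewrite -(subnKC an) addSn; move: (n - a.+1)%N => j {an}.
have fj0 i : 0 <= f (a + i)%N.
  by case: i => [|i]; rewrite ?addn0 // addnS; have /andP[] := Hf (a + i)%N (leq_addr _ _).
(* With the boundary term subtracted the bound telescopes, which makes the induction work. *)
suff H : `|\sum_(a <= k < (a + j).+1) u k * f k
          - (\sum_(a <= k < (a + j).+1) u k) * f (a + j)%N| <= B * (f a - f (a + j)%N).
  have HU := HB (a + j).+1 (leqW (leq_addr _ _)).
  have h2 : `|(\sum_(a <= k < (a + j).+1) u k) * f (a + j)%N| <= B * f (a + j)%N.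
    by rewrite normrM (ger0_norm (fj0 j)) ler_wpM2r.
  have := ler_normD (\sum_(a <= k < (a + j).+1) u k * f k
          - (\sum_(a <= k < (a + j).+1) u k) * f (a + j)%N)
          ((\sum_(a <= k < (a + j).+1) u k) * f (a + j)%N).
  by rewrite subrK; move: H h2; lra.
elim: j => [|j IH]; first by rewrite addn0 !big_nat1 !subrr normr0 mulr0.
rewrite addnS; set S := \sum_(a <= k < (a + j).+2) _.
rewrite big_nat_recr ?leqW ?leq_addr //= {}/S big_nat_recr ?leqW ?leq_addr //=.
set U := \sum_(a <= k < (a + j).+1) u k in IH *.
set V := \sum_(a <= k < (a + j).+1) _ in IH *.
have -> : V + u (a + j).+1 * f (a + j).+1 - (U + u (a + j).+1) * f (a + j).+1 =
  (V - U * f (a + j)%N) + U * (f (a + j)%N - f (a + j).+1) by ring.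
have /andP[_ fle] := Hf (a + j)%N (leq_addr _ _).
have hU : `|U * (f (a + j)%N - f (a + j).+1)| <= B * (f (a + j)%N - f (a + j).+1).
  rewrite normrM (ger0_norm (_ : 0 <= f (a + j)%N - f (a + j).+1)) ?subr_ge0 //.
  by rewrite ler_wpM2r ?subr_ge0 // HB // leqW // leq_addr.
by apply: le_trans (ler_normD _ _) _; lra.
Qed.

Lemma sum_squares_le f D : (forall k, 0 <= f k) ->
  \sum_(1 <= m < D.+1) f (m ^ 2)%N <= \sum_(1 <= k < (D ^ 2).+1) f k.
Proof.
move=> f0; elim: D => [|D IH]; first by rewrite !big_geq.
rewrite big_nat_recr //= [leRHS](@big_cat_nat _ _ _ (D ^ 2).+1) //=; last first.
  by rewrite ltnS leq_exp2r.
apply: lerD => //; rewrite big_nat_recr /=; last by rewrite ltn_sqr.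
by rewrite lerDr sumr_ge0.
Qed.

Lemma ln_succ_le n : ln (n.+1%:R : R) <= \sum_(1 <= m < n.+1) m%:R^-1.
Proof.
elim: n => [|n IH]; first by rewrite big_geq // ln1.
rewrite big_nat_recr //=.
have n0 : 0 < n.+1%:R :> R by rewrite ltr0n.
have -> : n.+2%:R = n.+1%:R * (1 + n.+1%:R^-1) :> R.
  by rewrite mulrDr mulr1 divff ?gt_eqF // natr1.
have i0 : 0 < n.+1%:R^-1 :> R by rewrite invr_gt0.
rewrite lnM ?posrE ?addr_gt0 //.
by apply: lerD => //; apply: le_ln1Dx; apply: lt_trans i0; rewrite ltrN10.
Qed.

Lemma ln_nat_unbounded (K : R) : exists2 n, (0 < n)%N & K <= ln n%:R.
Proof.
exists (Num.truncn (expR K)).+1 => //.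
have h : expR K < (Num.truncn (expR K)).+1%:R by rewrite truncnS_gt.
rewrite -[X in X <= _](expRK K) ler_ln ?posrE ?expR_gt0 //; exact: ltW.
Qed.

Lemma ln2_ge : 1 / 2 <= ln 2 :> R.
Proof.
have : ln (1 + - (1 / 2)) <= - (1 / 2) :> R by apply: le_ln1Dx; lra.
have -> : 1 + - (1 / 2) = 2^-1 :> R by field.
by rewrite lnV ?posrE; lra.
Qed.

(** ln x / x decreases once ln x >= 1; the start at 4 is convenient because ln 4 = 2 ln 2 >= 1
    follows from [ln2_ge]. *)
Lemma ln_ratio_antitone k : (4 <= k)%N ->
  0 <= ln (k.+1%:R : R) / k.+1%:R <= ln (k%:R : R) / k%:R.
Proof.
move=> k4; have k0 : 0 < k%:R :> R by rewrite ltr0n; lia.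
have k10 : 0 < k.+1%:R :> R by rewrite ltr0n.
have k1 : 1 <= k%:R :> R by rewrite ler1n; lia.
have kk : k.+1%:R = k%:R + 1 :> R by rewrite natr1.
apply/andP; split; first by rewrite divr_ge0 // ?ln_ge0 // ?kk; lra.
have lk1 : 1 <= ln (k%:R : R).
  apply: (@le_trans _ _ (ln 4)); last by rewrite ler_ln ?posrE // (ler_nat _ 4 k).
  have -> : 4 = 2 * 2 :> R by ring.
  by rewrite lnM ?posrE //; have := ln2_ge; lra.
rewrite ler_pdivrMr // mulrAC ler_pdivlMr //.
have -> : k.+1%:R = k%:R * (1 + k%:R^-1) :> R by rewrite mulrDr mulr1 divff ?gt_eqF // natr1.
have i0 : 0 < k%:R^-1 :> R by rewrite invr_gt0.
rewrite lnM ?posrE ?addr_gt0 //.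
have h : ln (1 + k%:R^-1 : R) <= k%:R^-1 by apply: le_ln1Dx; apply: lt_trans i0; rewrite ltrN10.
have -> : ln (k%:R : R) * (k%:R * (1 + k%:R^-1)) = ln (k%:R : R) * k%:R + ln (k%:R : R).
  by rewrite mulrDr mulr1 divff ?gt_eqF // mulrDr mulr1.
rewrite mulrDl lerD2l; apply: (@le_trans _ _ (k%:R^-1 * k%:R)).
  by rewrite ler_wpM2r // ltW.
by rewrite mulVf // gt_eqF.
Qed.
End FiniteSums.

(** * The von Mangoldt function, Chebyshev's bound, and sums of 1 / sqrt n *)

Section VonMangoldt.
Context {R : realType}.

Definition von_mangoldt (d : nat) : R :=
  if (1 < d)%N && (d == pdiv d ^ logn (pdiv d) d)%N then ln (pdiv d)%:R else 0.

Lemma von_mangoldt_ge0 d : 0 <= von_mangoldt d.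
Proof.
by rewrite /von_mangoldt; case: ifP => // _; rewrite ln_ge0 // ler1n pdiv_gt0.
Qed.

Lemma von_mangoldt_neq0 d : von_mangoldt d != 0 ->
  exists p j, [/\ prime p, (0 < j)%N & d = (p ^ j)%N].
Proof.
rewrite /von_mangoldt; case: ifP => [/andP[d1 /eqP dE] _|]; last by rewrite eqxx.
exists (pdiv d), (logn (pdiv d) d); split=> //; first exact: pdiv_prime.
by rewrite lt0n; apply/eqP => j0; move: dE d1; rewrite j0 => ->.
Qed.

Lemma von_mangoldt_prime_power p j : prime p -> (0 < j)%N ->
  von_mangoldt (p ^ j)%N = ln p%:R.
Proof.
move=> p_pr; case: j => // j _; rewrite /von_mangoldt pdiv_pfactor //.
by rewrite pfactorK // eqxx andbT ifT // -{1}(exp1n j.+1) ltn_exp2r // prime_gt1.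
Qed.

(* Dividing k by a prime p removes from the prime power divisors of k exactly
   the largest power of p. *)
Lemma sum_von_mangoldt k N : (0 < k <= N)%N ->
  \sum_(1 <= d < N.+1 | (d %| k)%N) von_mangoldt d = ln k%:R.
Proof.
elim/ltn_ind: k => k IH /andP[k0 kN].
have [k1|k1] := leqP k 1.
  have -> : k = 1%N by lia.
  rewrite ln1 big1 // => d; rewrite dvdn1 => /eqP ->.
  by rewrite /von_mangoldt.
have p_pr := pdiv_prime k1; set p := pdiv k in p_pr.
have p0 : (0 < p)%N := prime_gt0 p_pr.
have [m kE] : exists m, k = (p * m)%N.
  by have /dvdnP[m ->] := pdiv_dvd k; exists m; rewrite mulnC.
have m0 : (0 < m)%N by move: k0; rewrite kE muln_gt0 => /andP[].
have mk : (m < k)%N by rewrite kE ltn_Pmull // prime_gt1.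
set a := (logn p m).+1.
have pak : (p ^ a %| k)%N by rewrite kE pfactor_dvdn ?muln_gt0 ?p0 // lognM // logn_prime // eqxx.
have panm : ~~ (p ^ a %| m)%N by rewrite pfactor_dvdn // ltnn.
rewrite (bigID (fun d => d %| m)%N) /=.
have -> : \sum_(1 <= d < N.+1 | (d %| k)%N && (d %| m)%N) von_mangoldt d = ln m%:R.
  rewrite -(IH m mk) ?m0 ?(leq_trans (ltnW mk)) //; apply: eq_bigl => d.
  by case: (boolP (d %| m)%N) => [dm|]; rewrite ?andbF // kE dvdn_mull.
rewrite big_mkcond (bigD1_seq (p ^ a)%N) ?iota_uniq //=; last first.
  rewrite mem_index_iota expn_gt0 p0 ltnS.
  by apply: leq_trans kN; apply: dvdn_leq.
rewrite pak panm von_mangoldt_prime_power //= big1 ?addr0 => [|d dpa].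
  by rewrite kE natrM lnM ?posrE ?ltr0n // addrC.
case: ifP => // /andP[dk dm]; apply: contraTeq dpa => /von_mangoldt_neq0.
case=> r [j [r_pr j0 dE]]; rewrite negbK dE.
have [rp|rp] := eqVneq r p; last first.
  move: dk dm; rewrite dE kE Gauss_dvdr ?(negbTE _) // => [-> //|].
  by rewrite coprimeXl // prime_coprime // dvdn_prime2.
rewrite rp; apply/eqP; congr (_ ^ _)%N; apply/eqP; rewrite eqn_leq /a.
move: dk dm; rewrite dE rp kE pfactor_dvdn ?muln_gt0 ?p0 // lognM // logn_prime // eqxx.
by rewrite pfactor_dvdn // -ltnNge add1n => -> ->.
Qed.

Definition chebyshev_psi N : R := \sum_(1 <= d < N.+1) von_mangoldt d.

Lemma ln_factE N : ln (N`!%:R : R) = \sum_(1 <= d < N.+1) von_mangoldt d * (N %/ d)%:R.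
Proof.
transitivity (\sum_(1 <= k < N.+1) ln (k%:R : R)).
  elim: N => [|N IH]; first by rewrite big_geq // ln1.
  by rewrite big_nat_recr //= -IH factS natrM lnM ?posrE ?ltr0n ?fact_gt0 // addrC.
transitivity (\sum_(1 <= k < N.+1) \sum_(1 <= d < N.+1 | (d %| k)%N) von_mangoldt d).
  by apply: eq_big_nat => k /andP[k0 kN]; rewrite sum_von_mangoldt // k0.
rewrite (sum_divisor_pairs (fun d _ => von_mangoldt d)); apply: eq_bigr => d _.
by rewrite sumr_const_nat subn1 mulr_natr.
Qed.

(** Written with [von_mangoldt], the logarithm of the central binomial coefficient has coefficients
    floor(2n / d) - 2 floor(n / d), which are nonnegative, and 1 for n < d <= 2n; the coefficient
    itself is at most 4^n. *)
Lemma chebyshev_psi_double n :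
  chebyshev_psi n.*2 <= chebyshev_psi n + n.*2%:R * ln 2.
Proof.
have E : ln (n.*2`!%:R : R) = ln ('C(n.*2, n)%:R) + (ln n`!%:R + ln n`!%:R).
  rewrite -(@bin_fact n.*2 n); last by rewrite -addnn leq_addr.
  have -> : (n.*2 - n = n)%N by rewrite -addnn addnK.
  rewrite !natrM !lnM ?posrE ?mulr_gt0 ?ltr0n ?fact_gt0 ?bin_gt0 //.
  by rewrite -addnn leq_addr.
have C4 : ln ('C(n.*2, n)%:R : R) <= n.*2%:R * ln 2.
  have -> : n.*2%:R * ln 2 = ln ((2 ^ n.*2)%:R) :> R.
    by rewrite natrX lnXn // mulr_natl.
  rewrite ler_ln ?posrE ?ltr0n ?bin_gt0 ?expn_gt0 //; last by rewrite -addnn leq_addr.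
  rewrite ler_nat -[(2 ^ _)%N](_ : \sum_(i < n.*2.+1) 'C(n.*2, i) = _)%N.
    have nn : (n < n.*2.+1)%N by rewrite ltnS -addnn leq_addr.
    by rewrite (bigD1 (Ordinal nn)) //= leq_addr.
  by rewrite (expnDn 1 1 n.*2) ; apply: eq_bigr => i _; rewrite !exp1n !muln1.
suff : chebyshev_psi n.*2 - chebyshev_psi n <= ln ('C(n.*2, n)%:R : R) by move: C4; lra.
have nn : (n.+1 <= n.*2.+1)%N by rewrite ltnS -addnn leq_addr.
have -> : ln ('C(n.*2, n)%:R : R) = ln (n.*2`!%:R) - (ln n`!%:R + ln n`!%:R) by rewrite E; ring.
have -> : ln (n`!%:R : R) = \sum_(1 <= d < n.*2.+1) von_mangoldt d * (n %/ d)%:R.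
  rewrite ln_factE [RHS](@big_cat_nat _ _ _ n.+1) //= [X in _ + X]big1_seq ?addr0 //.
  by move=> d; rewrite mem_index_iota => /andP[_ /andP[nd _]]; rewrite divn_small ?mulr0.
rewrite ln_factE -big_split -sumrB /=.
have -> : chebyshev_psi n.*2 - chebyshev_psi n = \sum_(n.+1 <= d < n.*2.+1) von_mangoldt d.
  by rewrite /chebyshev_psi (@big_cat_nat _ _ _ n.+1 1 n.*2.+1) //=; ring.
have term_ge0 d : (0 < d)%N -> 0 <= von_mangoldt d * (n.*2 %/ d)%:R
    - (von_mangoldt d * (n %/ d)%:R + von_mangoldt d * (n %/ d)%:R).
  move=> d0; rewrite -mulrDr -mulrBr mulr_ge0 ?von_mangoldt_ge0 // -natrD subr_ge0 ler_nat.
  by rewrite leq_divRL // mulnDl -addnn leq_add // leq_divM.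
rewrite [leRHS](@big_cat_nat _ _ _ n.+1) //= -[leLHS]add0r; apply: lerD.
  by rewrite big_nat_cond sumr_ge0 // => d /andP[/andP[d0 _] _]; apply: term_ge0.
apply: ler_sum_nat => d /andP[nd d2].
rewrite (@divn_small n d) // mulr0 addr0 subr0 ler_peMr ?von_mangoldt_ge0 //.
by rewrite ler1n divn_gt0 //; lia.
Qed.

Lemma chebyshev_psi_le N : chebyshev_psi N <= N%:R * (4 * ln 2).
Proof.
have l2 := @ln2_ge R.
elim/ltn_ind: N => N IH; have [N1|N1] := leqP N 1.
  have -> : chebyshev_psi N = 0.
    rewrite /chebyshev_psi big_nat_cond big1 // => d /andP[/andP[d1 dN] _].
    by have -> : d = 1%N by lia.
  by rewrite mulr_ge0 //; lra.
have [m Em Nm] : exists2 m, (N <= m.*2)%N & (m.*2 <= N.+1)%N /\ (m < N)%N.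
  by exists (uphalf N); lia.
have psi_mono : chebyshev_psi N <= chebyshev_psi m.*2.
  rewrite /chebyshev_psi (@big_cat_nat _ _ _ N.+1 1 m.*2.+1) //= lerDl.
  by rewrite sumr_ge0 // => d _; apply: von_mangoldt_ge0.
apply: (le_trans psi_mono); apply: (le_trans (chebyshev_psi_double m)).
have := IH m Nm.2.
(* The induction needs 4 m + 2 m <= 4 N, which follows from 2 m <= N + 1 and N > 1. *)
have : m.*2%:R * 3 <= N%:R * 4 :> R by rewrite -!natrM ler_nat; lia.
have -> : m.*2%:R = m%:R * 2 :> R by rewrite -muln2 natrM.
move=> h1 h2; have : (m%:R * 2 * 3) * ln 2 <= (N%:R * 4) * ln 2 :> R by rewrite ler_wpM2r //; lra.
by move: h2; lra.
Qed.

Definition sqrt_sum n : R := \sum_(1 <= e < n.+1) (Num.sqrt e%:R)^-1.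

Lemma sqrt_nat_gt0 n : (0 < n)%N -> 0 < Num.sqrt (n%:R : R).
Proof. by move=> n0; rewrite sqrtr_gt0 ltr0n. Qed.

Lemma sqrt_step n : (0 < n)%N ->
  (Num.sqrt (n.+1%:R : R))^-1 <= 2 * (Num.sqrt n.+1%:R - Num.sqrt n%:R)
    <= (Num.sqrt (n%:R : R))^-1.
Proof.
move=> n0; set s := Num.sqrt (n%:R : R); set t := Num.sqrt (n.+1%:R : R).
have s0 : 0 < s by apply: sqrt_nat_gt0.
have t0 : 0 < t by apply: sqrt_nat_gt0.
have st : t ^+ 2 = s ^+ 2 + 1 by rewrite !sqr_sqrtr // natr1.
have h := sqr_ge0 (t - s).
apply/andP; split.
  by rewrite -div1r ler_pdivrMr //; lra.
by rewrite -[leRHS]div1r ler_pdivlMr //; lra.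
Qed.

Lemma sqrt_sum_le n : sqrt_sum n <= 2 * Num.sqrt n%:R.
Proof.
elim: n => [|n IH]; first by rewrite /sqrt_sum big_geq // sqrtr0 mulr0.
rewrite /sqrt_sum big_nat_recr //= -/(sqrt_sum n); case: n IH => [|n] IH.
  by rewrite /sqrt_sum big_geq // sqrtr1; lra.
by have /andP[] := sqrt_step n.+1 isT; move: IH; lra.
Qed.

(** By [sqrt_step], [sqrt_sum n] - 2 sqrt n decreases by at most 1 / sqrt n - 1 / sqrt(n + 1) at
    each step, and these bounds telescope. *)
Lemma sqrt_sum_defect n m : (0 < n <= m)%N ->
  0 <= (sqrt_sum n - 2 * Num.sqrt n%:R) - (sqrt_sum m - 2 * Num.sqrt m%:R)
    <= (Num.sqrt n%:R)^-1 - (Num.sqrt m%:R)^-1.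
Proof.
move=> /andP[n0 nm]; rewrite -(subnKC nm); elim: (m - n)%N => [|j IH].
  by rewrite addn0 !subrr lexx.
rewrite addnS /sqrt_sum [X in _ - (X - _)]big_nat_recr //= -!/(sqrt_sum _).
have /andP[] := sqrt_step (n + j) (ltn_addr _ n0).
by move: IH => /andP[]; lra.
Qed.

(* The implied constant of H(n) = 2 sqrt n + c + O(1 / sqrt n) is replaced by
   the defect at m, so that no limit is needed. *)
Lemma sqrt_sum_div m d : (0 < d <= m)%N ->
  `|sqrt_sum (m ^ 2 %/ d) - (2 * m%:R / Num.sqrt d%:R
     + (sqrt_sum (m ^ 2) - 2 * m%:R))| <= 4 * Num.sqrt d%:R / m%:R.
Proof.
move=> /andP[d0 dm]; set n := (m ^ 2 %/ d)%N.
have m0 : (0 < m)%N := leq_trans d0 dm.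
have mR : 0 < m%:R :> R by rewrite ltr0n.
have n0 : (0 < n)%N by rewrite divn_gt0 //; apply: leq_trans dm _; rewrite leq_pmulr.
have nm : (n <= m ^ 2)%N by apply: leq_div.
have /andP[lo hi] := @sqrt_sum_defect n (m ^ 2) ltac:(by rewrite n0).
have sm : Num.sqrt ((m ^ 2)%:R : R) = m%:R by rewrite natrX sqrtr_sqr ger0_norm ?ltW.
rewrite sm in lo hi.
set r := Num.sqrt (d%:R : R); set q := Num.sqrt (n%:R : R) in lo hi *.
have r0 : 0 < r by apply: sqrt_nat_gt0.
have q0 : 0 < q by apply: sqrt_nat_gt0.
(* [y] is [q] without the floor: below, y - q <= 1 / y and 1 / q <= 2 / y. *)
pose y := m%:R / r.
have y0 : 0 < y by rewrite divr_gt0.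
have yr : y * r = m%:R by rewrite divfK ?gt_eqF.
have -> : 4 * r / m%:R = 4 * y^-1 by rewrite /y invf_div mulrA.
have -> : 2 * m%:R / r = 2 * y by rewrite /y mulrA.
have rr : r ^+ 2 = d%:R by rewrite sqr_sqrtr.
have qq : q ^+ 2 = n%:R by rewrite sqr_sqrtr.
have y2 : y ^+ 2 * d%:R = (m ^ 2)%:R by rewrite -rr -exprMn yr natrX.
have dR : 0 < d%:R :> R by rewrite ltr0n.
have qy : q ^+ 2 <= y ^+ 2.
  by rewrite -(ler_pM2r dR) y2 qq -natrM ler_nat leq_divM.
have yq : y ^+ 2 <= q ^+ 2 + 1.
  by rewrite -(ler_pM2r dR) y2 qq natr1 -natrM ler_nat ltnW // -ltn_divLR.
have q1 : 1 <= q ^+ 2 by rewrite qq ler1n.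
have q_le_y : q <= y by rewrite -(@ler_pXn2r _ 2) ?nnegrE // ltW.
have yq1 : y - q <= y^-1.
  rewrite -[leRHS]div1r ler_pdivlMr //.
  have : q ^+ 2 <= q * y by rewrite expr2 ler_pM2l.
  by move: yq; rewrite expr2; lra.
have qV : q^-1 <= 2 * y^-1.
  rewrite -[leLHS]div1r ler_pdivrMr // mulrAC ler_pdivlMr // mul1r.
  have q2 : 0 <= 2 * q by lra.
  rewrite -(@ler_pXn2r _ 2) ?nnegrE ?(ltW y0) //.
  by move: yq q1; lra.
have mV : 0 < m%:R^-1 :> R by rewrite invr_gt0.
by rewrite ler_norml; apply/andP; split; lra.
Qed.

End VonMangoldt.

(** * Real characters and their divisor sums *)

Section RealCharacter.
Context {R : realType}.

(** Zeros off the residues prime to [M] are not demanded, so a character whose conductor divides [M]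
    qualifies as it stands. *)
Definition real_char (M : nat) (chi : nat -> R) :=
  [/\ chi 1%N = 1, forall a b, chi (a * b)%N = chi a * chi b,
      forall a, chi (a %% M)%N = chi a & forall a, chi a \in [:: 0; 1; -1]].

Definition divisor_sum (chi : nat -> R) k := \sum_(1 <= d < k.+1 | (d %| k)%N) chi d.

Definition char_sum (chi : nat -> R) N := \sum_(1 <= k < N.+1) chi k / k%:R.

Definition char_mangoldt_sum (chi : nat -> R) N :=
  \sum_(1 <= d < N.+1) chi d * von_mangoldt d / d%:R.

Context {M : nat} {chi : nat -> R} (M0 : (0 < M)%N) (chi_char : real_char M chi).

Lemma char1 : chi 1%N = 1. Proof. by case: chi_char. Qed.
Lemma charM a b : chi (a * b)%N = chi a * chi b. Proof. by case: chi_char. Qed.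
Lemma char_mod a : chi (a %% M)%N = chi a. Proof. by case: chi_char. Qed.

Lemma char_norm_le1 a : `|chi a| <= 1.
Proof.
case: chi_char => _ _ _ /(_ a); rewrite !inE.
by case/or3P=> /eqP ->; rewrite ?normrN ?normr0 ?normr1.
Qed.

Lemma charX a j : chi (a ^ j)%N = chi a ^+ j.
Proof. by elim: j => [|j IH]; rewrite ?expn0 ?char1 // expnS charM IH exprS. Qed.

(** The finite form of - L' = L (- L' / L): ln k is the sum of [von_mangoldt] over the divisors of
    k. *)
Lemma char_sum_mangoldtE N :
  \sum_(1 <= k < N.+1) chi k * (ln k%:R / k%:R) =
  \sum_(1 <= d < N.+1) chi d * von_mangoldt d / d%:R * char_sum chi (N %/ d).
Proof.
transitivity (\sum_(1 <= k < N.+1) \sum_(1 <= d < N.+1 | (d %| k)%N)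
    chi d * von_mangoldt d / d%:R * (chi (k %/ d)%N / (k %/ d)%:R)).
  apply: eq_big_nat => k /andP[k0 kN].
  rewrite -(sum_von_mangoldt k N) ?k0 // mulr_suml mulr_sumr.
  apply: eq_bigr => d dk; rewrite -{1}(divnK dk) charM.
  have -> : k%:R = (k %/ d)%:R * d%:R :> R by rewrite -natrM divnK.
  by rewrite invfM; ring.
rewrite (sum_divisor_pairs (fun d e => chi d * von_mangoldt d / d%:R * (chi e / e%:R))).
by apply: eq_bigr => d _; rewrite mulr_sumr.
Qed.

Lemma divisor_sum_range k N : (0 < k <= N)%N ->
  \sum_(1 <= d < N.+1 | (d %| k)%N) chi d = divisor_sum chi k.
Proof.
move=> /andP[k0 kN]; rewrite (@big_cat_nat _ _ _ k.+1) //= [X in _ + X]big1_seq ?addr0 //.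
move=> d /andP[dk]; rewrite mem_index_iota => /andP[kd _].
by have := dvdn_leq k0 dk; rewrite leqNgt kd.
Qed.

(** Divisors prime to p divide m; the others are p times a divisor of the number with one factor p
    less. Induction on a yields the geometric sum. *)
Lemma divisor_sum_prime_power p a m : prime p -> (0 < m)%N -> ~~ (p %| m)%N ->
  divisor_sum chi (p ^ a * m) = divisor_sum chi m * \sum_(0 <= j < a.+1) chi p ^+ j.
Proof.
move=> p_pr m0 pm; have p0 := prime_gt0 p_pr.
elim: a => [|a IH]; first by rewrite mul1n big_nat1 expr0 mulr1.
have k0 : (0 < p ^ a * m)%N by rewrite muln_gt0 expn_gt0 p0.
have pk0 : (0 < p ^ a.+1 * m)%N by rewrite muln_gt0 expn_gt0 p0.
rewrite {1}/divisor_sum (bigID (fun d => p %| d)%N) /= addrC.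
have -> : \sum_(1 <= d < (p ^ a.+1 * m).+1 | (d %| p ^ a.+1 * m)%N && ~~ (p %| d)%N) chi d
    = divisor_sum chi m.
  rewrite -(@divisor_sum_range m (p ^ a.+1 * m)); last by rewrite m0 leq_pmull // expn_gt0 p0.
  apply: eq_bigl => d; case: (boolP (p %| d)%N) => [pd|pd] /=.
    by rewrite andbF; apply/esym/negbTE; apply: contra pm; apply: dvdn_trans.
  by rewrite andbT Gauss_dvdr // coprime_sym coprimeXl // prime_coprime.
have -> : \sum_(1 <= d < (p ^ a.+1 * m).+1 | (d %| p ^ a.+1 * m)%N && (p %| d)%N) chi d
    = chi p * divisor_sum chi (p ^ a * m).
  pose G e := if (e %| p ^ a * m)%N then chi p * chi e else 0.
  transitivity (\sum_(1 <= d < (p ^ a.+1 * m).+1 | (p %| d)%N) G (d %/ p)%N).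
    rewrite big_mkcond [RHS]big_mkcond; apply: eq_bigr => d _.
    rewrite andbC; case: (boolP (p %| d)%N) => //= /dvdnP[e ->].
    by rewrite /G mulnK // expnS -mulnA [(e * p)%N]mulnC dvdn_pmul2l // charM.
  rewrite sum_multiples // expnS -mulnA mulKn //.
  by rewrite /G -big_mkcond /= -mulr_sumr.
rewrite IH big_nat_recl //= expr0 mulrDr mulr1; congr (_ + _).
by rewrite mulrCA mulr_sumr; congr (_ * _); apply: eq_bigr => j _; rewrite exprS.
Qed.

Lemma geometric_char_ge0 p a :
  (0 <= \sum_(0 <= j < a.+1) chi p ^+ j) /\
  (~~ odd a -> 1 <= \sum_(0 <= j < a.+1) chi p ^+ j).
Proof.
have chi3 : chi p \in [:: 0; 1; -1] by case: chi_char.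
have Hs : forall a, if chi p == -1 then \sum_(0 <= j < a.+1) chi p ^+ j = (~~ odd a)%:R
    else 1 <= \sum_(0 <= j < a.+1) chi p ^+ j.
  move: chi3; rewrite !inE => /or3P[] /eqP -> {}a.
  - rewrite ifF; last by apply/eqP; lra.
    rewrite big_nat_recl //= expr0 big1 ?addr0 // => j _; by rewrite exprS mul0r.
  - rewrite ifF; last by apply/eqP; lra.
    rewrite (eq_bigr (fun=> 1)) => [|j _]; last by rewrite expr1n.
    by rewrite sumr_const_nat subn0 ler1n.
  rewrite eqxx; elim: a => [|a IH]; first by rewrite big_nat1 expr0.
  rewrite big_nat_recr //= IH -signr_odd /=.
  by case: (odd a); rewrite /= ?expr0 ?expr1; ring.
have := Hs a; case: ifP => _ H; rewrite ?H; split=> //; try lra.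
by move=> ->.
Qed.

(** The sum is a product of geometric sums over the prime powers in k, each nonnegative, and at
    least 1 for an even exponent. *)
Lemma divisor_sum_ge0 k : (0 < k)%N ->
  0 <= divisor_sum chi k /\ ((forall p, ~~ odd (logn p k)) -> 1 <= divisor_sum chi k).
Proof.
elim/ltn_ind: k => k IH k0; have [k1|k1] := leqP k 1.
  have -> : k = 1%N by lia.
  rewrite /divisor_sum big_mkcond big_nat1 dvdnn char1.
  by split=> // _.
have p_pr := pdiv_prime k1; have [m cop kE] := pfactor_coprime p_pr k0.
have a0 : (0 < logn (pdiv k) k)%N by rewrite logn_gt0 mem_primes p_pr k0 pdiv_dvd.
move: (pdiv k) p_pr cop kE a0 => p p_pr cop; set a := logn p k => kE a0.
have pm : ~~ (p %| m)%N by rewrite -prime_coprime.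
have m0 : (0 < m)%N by case: m kE {cop pm} => // ke; move: k0; rewrite ke.
have mk : (m < k)%N.
  by rewrite kE -{1}[m]muln1 ltn_pmul2l // -(expn0 p) ltn_exp2l // prime_gt1.
have [IH1 IH2] := IH m mk m0.
have [g1 g2] := geometric_char_ge0 p a.
rewrite kE mulnC divisor_sum_prime_power //; split; first exact: mulr_ge0.
move=> ev; have h1 : 1 <= divisor_sum chi m.
  apply: IH2 => r; have := ev r.
  have pa0 : (0 < p ^ a)%N by rewrite expn_gt0 prime_gt0.
  rewrite (lognM _ pa0 m0) lognX oddD; have [->|rp] := eqVneq r p.
    by rewrite (logn_coprime cop).
  case: (boolP (prime r)) => [r_pr|]; last by rewrite /logn => /negbTE ->.
  by rewrite (logn_prime _ p_pr) (negbTE rp) muln0.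
have h2 : 1 <= \sum_(0 <= j < a.+1) chi p ^+ j.
  by apply: g2; have := ev p; rewrite mulnC -kE.
by rewrite -[1]mulr1; apply: ler_pM.
Qed.

Lemma divisor_sum_square_ge1 m : (0 < m)%N -> 1 <= divisor_sum chi (m ^ 2).
Proof.
move=> m0; have [|_] := divisor_sum_ge0 (m ^ 2); first by rewrite expn_gt0 m0.
by apply=> p; rewrite lognX mul2n odd_double.
Qed.

(** Only the squares k = m^2 are kept; each contributes at least 1 / m. *)
Lemma sqrt_divisor_sum_lower D :
  ln D.+1%:R <= \sum_(1 <= k < (D ^ 2).+1) divisor_sum chi k / Num.sqrt k%:R.
Proof.
apply: (le_trans (ln_succ_le D)).
apply: le_trans (@sum_squares_le _ (fun k => divisor_sum chi k / Num.sqrt k%:R) D _).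
  apply: ler_sum_nat => m /andP[m0 _]; rewrite natrX sqrtr_sqr ger0_norm //.
  by rewrite -[leLHS]mul1r ler_wpM2r ?invr_ge0 // divisor_sum_square_ge1.
case=> [|k]; first by rewrite /divisor_sum big_geq // mul0r.
by rewrite divr_ge0 ?sqrtr_ge0 //; case: (divisor_sum_ge0 k.+1).
Qed.

Context (chi_sum0 : \sum_(0 <= k < M) chi k = 0).

Lemma char_partial_sum a c : `|\sum_(a <= k < c) chi k| <= 2 * M%:R.
Proof.
(* Full periods cancel, leaving fewer than M terms; the general sum is a difference of two initial
   ones. *)
have ini n : `|\sum_(0 <= k < n) chi k| <= M%:R.
  have -> : \sum_(0 <= k < n) chi k = \sum_(0 <= k < n %% M) chi k.
    rewrite {1}(divn_eq n M); elim: (n %/ M)%N => [|j IH]; first by rewrite mul0n.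
    rewrite mulSn -addnA (@big_cat_nat _ _ _ M) ?leq_addr //= chi_sum0 add0r -IH.
    rewrite -{1}[M]add0n big_addn addKn; apply: eq_bigr => i _.
    by rewrite -char_mod modnDr char_mod.
  apply: le_trans (ler_norm_sum _ _ _) _.
  apply: (@le_trans _ _ (\sum_(0 <= k < n %% M) 1)).
    by apply: ler_sum => k _; apply: char_norm_le1.
  by rewrite sumr_const_nat subn0 ler_nat ltnW // ltn_mod.
have [ca|ac] := leqP c a; first by rewrite big_geq // normr0 mulr_ge0.
have -> : \sum_(a <= k < c) chi k = \sum_(0 <= k < c) chi k - \sum_(0 <= k < a) chi k.
  by rewrite (@big_cat_nat _ _ _ a 0 c) //= ?(ltnW ac) // addrAC subrr add0r.
by apply: le_trans (ler_normB _ _) _; have := ini a; have := ini c; lra.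
Qed.

Lemma char_abel (f : nat -> R) a n :
  (forall k, (a <= k)%N -> 0 <= f k.+1 <= f k) -> 0 <= f a ->
  `|\sum_(a <= k < n) chi k * f k| <= 2 * M%:R * f a.
Proof. by apply: abel_bound => c _; apply: char_partial_sum. Qed.

Lemma char_sum_diff n m : (n <= m)%N ->
  `|char_sum chi m - char_sum chi n| <= 2 * M%:R / n.+1%:R.
Proof.
move=> nm; rewrite /char_sum (@big_cat_nat _ _ _ n.+1 1 m.+1) //= addrAC subrr add0r.
apply: (@char_abel (fun k => k%:R^-1)); last by rewrite invr_ge0.
move=> k nk; have k0 : (0 < k)%N := leq_ltn_trans (leq0n n) nk.
by rewrite invr_ge0 ler0n /= lef_pV2 ?posrE ?ltr0n // ler_nat.
Qed.

Lemma char_ln_sum_bounded : exists C, forall N,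
  `|\sum_(1 <= k < N.+1) chi k * (ln k%:R / k%:R)| <= C.
Proof.
pose F k : R := chi k * (ln k%:R / k%:R).
pose S := \sum_(1 <= k < 4) `|F k|.
have l4 : 0 <= ln (4%:R : R) / 4%:R by rewrite divr_ge0 ?ln_ge0 // ler1n.
exists (S + 2 * M%:R * (ln 4%:R / 4%:R)) => N.
have [N4|N4] := leqP N 3.
  apply: (@le_trans _ _ S); last by rewrite lerDl; apply: mulr_ge0 => //; apply: mulr_ge0.
  apply: le_trans (ler_norm_sum _ _ _) _.
  by rewrite /S [leRHS](@big_cat_nat _ _ _ N.+1) //= lerDl sumr_ge0.
rewrite (@big_cat_nat _ _ _ 4) //=; last by lia.
apply: le_trans (ler_normD _ _) _; apply: lerD; first exact: ler_norm_sum.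
by apply: char_abel => // k k4; apply: ln_ratio_antitone.
Qed.
End RealCharacter.

(** * Nonprincipal characters: partial sums of L(1, chi) stay away from 0 *)

Section NonPrincipal.
Context {R : realType} {M : nat} {chi : nat -> R}.
Context (M0 : (0 < M)%N) (chi_char : real_char M chi).
Context (chi_sum0 : \sum_(0 <= k < M) chi k = 0).
Local Notation B := (2 * M%:R).

Let char_abel := @char_abel R M chi M0 chi_char chi_sum0.

Lemma sqrt_char_sum_bounded n : `|\sum_(1 <= d < n) chi d * (Num.sqrt d%:R)^-1| <= B.
Proof.
have := @char_abel (fun d => (Num.sqrt d%:R)^-1) 1%N n; rewrite sqrtr1 invr1 mulr1.
apply=> // k k0; have s0 := @sqrt_nat_gt0 R k k0.
rewrite invr_ge0 sqrtr_ge0 /= lef_pV2 ?posrE ?sqrt_nat_gt0 //.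
by rewrite ler_wsqrtr // ler_nat.
Qed.

(** For d > D the sum over d is taken first: Abel summation bounds it by B / sqrt(D + 1) for each e
    <= D, and the 1 / sqrt e add up to at most 2 sqrt D. *)
Lemma hyperbola_large_part D : (0 < D)%N ->
  `|\sum_(D.+1 <= d < (D ^ 2).+1) \sum_(1 <= e < (D ^ 2 %/ d).+1)
     chi d * (Num.sqrt d%:R)^-1 * (Num.sqrt e%:R)^-1| <= 2 * B.
Proof.
move=> D0; pose F d e : R := chi d * (Num.sqrt d%:R)^-1 * (Num.sqrt e%:R)^-1.
rewrite (_ : \sum_(_ <= _ < _) _ =
  \sum_(1 <= e < D.+1) \sum_(D.+1 <= d < (D ^ 2 %/ e).+1) F d e); last first.
  transitivity (\sum_(D.+1 <= d < (D ^ 2).+1) \sum_(1 <= e < D.+1)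
     if (d * e <= D ^ 2)%N then F d e else 0).
    apply: eq_big_nat => d /andP[Dd dD]; have d0 : (0 < d)%N by apply: leq_ltn_trans Dd.
    have le_D : (D ^ 2 %/ d <= D)%N.
      by rewrite -ltnS ltn_divLR // expnS expn1; apply: (@leq_trans (D * D).+1); nia.
    rewrite [RHS](@big_cat_nat _ _ _ (D ^ 2 %/ d).+1) //= [X in _ = _ + X]big1_seq ?addr0.
      apply: eq_big_nat => e /andP[e0 eD]; rewrite ifT //.
      by rewrite mulnC -leq_divRL.
    move=> e; rewrite mem_index_iota => /andP[_ /andP[eD _]].
    by rewrite ifF //; apply/negbTE; rewrite -ltnNge mulnC -ltn_divLR.
  rewrite exchange_big_nat /=; apply: eq_big_nat => e /andP[e0 eD].
  have le_D2 : (D ^ 2 %/ e <= D ^ 2)%N by apply: leq_div.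
  have [small|big] := leqP D.+1 (D ^ 2 %/ e).+1; last first.
    rewrite [RHS]big_geq ?(ltnW big) // big1_seq // => d.
    rewrite mem_index_iota => /andP[_ /andP[Dd _]]; rewrite ifF //.
    apply/negbTE; rewrite -ltnNge -ltn_divLR //.
    by apply: leq_trans Dd; apply: ltnW.
  rewrite (@big_cat_nat _ _ _ (D ^ 2 %/ e).+1) //= [X in _ + X]big1_seq ?addr0.
    by apply: eq_big_nat => d /andP[d0 dD]; rewrite ifT // -leq_divRL.
  move=> d; rewrite mem_index_iota => /andP[_ /andP[dD _]].
  by rewrite ifF //; apply/negbTE; rewrite -ltnNge -ltn_divLR.
have D1 : 0 < Num.sqrt (D.+1%:R : R) by apply: sqrt_nat_gt0.
apply: le_trans (ler_norm_sum _ _ _) _.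
apply: (@le_trans _ _ (\sum_(1 <= e < D.+1) (Num.sqrt e%:R)^-1 * (B * (Num.sqrt D.+1%:R)^-1))).
  apply: ler_sum => e _; rewrite /F -mulr_suml mulrC normrM.
  rewrite ger0_norm ?invr_ge0 ?sqrtr_ge0 // ler_wpM2l ?invr_ge0 ?sqrtr_ge0 //.
  apply: (@char_abel (fun d => (Num.sqrt d%:R)^-1)); last by rewrite invr_ge0 sqrtr_ge0.
  move=> k Dk; have k0 : (0 < k)%N := leq_ltn_trans (leq0n D) Dk.
  rewrite invr_ge0 sqrtr_ge0 /= lef_pV2 ?posrE ?sqrt_nat_gt0 //.
  by rewrite ler_wsqrtr // ler_nat.
rewrite -mulr_suml -/(sqrt_sum D).
have h1 := @sqrt_sum_le R D.
have h2 : Num.sqrt D%:R <= Num.sqrt D.+1%:R :> R by rewrite ler_wsqrtr // ler_nat.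
have h3 : sqrt_sum D * (Num.sqrt D.+1%:R)^-1 <= 2 :> R.
  by rewrite ler_pdivrMr //; lra.
have B0 : 0 <= B :> R by rewrite mulr_ge0.
by rewrite mulrCA [leRHS]mulrC ler_wpM2l.
Qed.

(** [sqrt_sum_div] replaces the sum over e by 2 D / sqrt d + c. The first term gives the multiple of
    [char_sum], the constant c with |c| <= 2 meets a bounded sum, and the D errors are at most 4 / D
    each. *)
Lemma hyperbola_small_part D : (0 < D)%N ->
  `|\sum_(1 <= d < D.+1) \sum_(1 <= e < (D ^ 2 %/ d).+1)
     chi d * (Num.sqrt d%:R)^-1 * (Num.sqrt e%:R)^-1 - 2 * D%:R * char_sum chi D|
  <= 4 + 2 * B.
Proof.
move=> D0; have DR : 0 < D%:R :> R by rewrite ltr0n.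
set c : R := sqrt_sum (D ^ 2) - 2 * D%:R.
have c2 : `|c| <= 2.
  have := @sqrt_sum_defect R 1 (D ^ 2) ltac:(by rewrite expn_gt0 D0).
  have -> : Num.sqrt ((D ^ 2)%:R : R) = D%:R by rewrite natrX sqrtr_sqr ger0_norm ?ltW.
  rewrite -/c sqrtr1 invr1 /sqrt_sum big_nat1 sqrtr1 invr1 => /andP[h1 h2].
  have iD : 0 < D%:R^-1 :> R by rewrite invr_gt0.
  by rewrite ler_norml; apply/andP; split; lra.
pose err d : R := sqrt_sum (D ^ 2 %/ d) - (2 * D%:R / Num.sqrt d%:R + c).
have -> : \sum_(1 <= d < D.+1) \sum_(1 <= e < (D ^ 2 %/ d).+1)
     chi d * (Num.sqrt d%:R)^-1 * (Num.sqrt e%:R)^-1 - 2 * D%:R * char_sum chi D =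
  \sum_(1 <= d < D.+1) chi d * (Num.sqrt d%:R)^-1 * err d
  + c * \sum_(1 <= d < D.+1) chi d * (Num.sqrt d%:R)^-1.
  rewrite /char_sum !mulr_sumr -sumrB -big_split /=.
  apply: eq_big_nat => d /andP[d0 _]; rewrite -mulr_sumr -/(sqrt_sum _) /err.
  have dd : d%:R^-1 = (Num.sqrt d%:R)^-1 * (Num.sqrt d%:R)^-1 :> R.
    by rewrite -invfM -expr2 sqr_sqrtr.
  by rewrite dd; ring.
apply: le_trans (ler_normD _ _) _; apply: lerD.
  apply: le_trans (ler_norm_sum _ _ _) _.
  apply: (@le_trans _ _ (\sum_(1 <= d < D.+1) 4 / D%:R)).
    apply: ler_sum_nat => d /andP[d0 dD]; rewrite ltnS in dD.
    have s0 := @sqrt_nat_gt0 R d d0.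
    have := @sqrt_sum_div R D d ltac:(by rewrite d0); rewrite -/c -/(err d) => he.
    rewrite normrM normrM (ger0_norm (_ : 0 <= (Num.sqrt d%:R)^-1)) ?invr_ge0 ?sqrtr_ge0 //.
    apply: (@le_trans _ _ (1 * (Num.sqrt d%:R)^-1 * (4 * Num.sqrt d%:R / D%:R))).
      apply: ler_pM; rewrite ?mulr_ge0 ?invr_ge0 ?sqrtr_ge0 //.
      by rewrite ler_wpM2r ?invr_ge0 ?sqrtr_ge0 // (char_norm_le1 chi_char).
    by rewrite mul1r le_eqVlt; apply/orP; left; apply/eqP; field; rewrite !gt_eqF.
  by rewrite sumr_const_nat subn1 -[leLHS]mulr_natr divfK // gt_eqF.
rewrite normrM; apply: ler_pM => //; exact: sqrt_char_sum_bounded.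
Qed.

(* Dirichlet's hyperbola method: the left-hand side bounds from below the sum of
   (1 * chi)(k) / sqrt k for k <= D^2, as 1 * chi >= 0 is at least 1 on squares. *)
Lemma char_sum_lower D : (0 < D)%N ->
  ln D.+1%:R <= 2 * D%:R * char_sum chi D + (4 + 4 * B).
Proof.
move=> D0; apply: (le_trans (sqrt_divisor_sum_lower M0 chi_char D)).
have -> : \sum_(1 <= k < (D ^ 2).+1) divisor_sum chi k / Num.sqrt k%:R =
   \sum_(1 <= d < (D ^ 2).+1) \sum_(1 <= e < (D ^ 2 %/ d).+1)
     chi d * (Num.sqrt d%:R)^-1 * (Num.sqrt e%:R)^-1.
  rewrite -(sum_divisor_pairs (fun d e => chi d * (Num.sqrt d%:R)^-1 * (Num.sqrt e%:R)^-1)).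
  apply: eq_big_nat => k /andP[k0 kN].
  rewrite -(divisor_sum_range k (D ^ 2)) ?k0 // mulr_suml; apply: eq_bigr => d dk.
  by rewrite -mulrA -invfM -sqrtrM // -natrM mulnC divnK.
rewrite (@big_cat_nat _ _ _ D.+1) //=; last first.
  by rewrite ltnS expnS expn1 leq_pmulr.
have := hyperbola_small_part D D0; have := hyperbola_large_part D D0.
by rewrite !ler_norml => /andP[_ h1] /andP[_ h2]; lra.
Qed.

(** Takes the place of L(1, chi) > 0. Once ln D >= 8 B + 4, [char_sum_lower] gives at least 2 B / D
    at D, and later partial sums differ from this one by at most B / (D + 1). *)
Lemma char_sum_away_from_0 : exists delta N0, 0 < delta /\
  forall N, (N0 <= N)%N -> delta <= char_sum chi N.
Proof.
have [D D0 HD] := @ln_nat_unbounded R (8 * B + 4).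
have DR : 0 < D%:R :> R by rewrite ltr0n.
have MR : 0 < M%:R :> R by rewrite ltr0n.
exists (B / D%:R), D; split; first by rewrite divr_gt0 // mulr_gt0.
move=> N DN; have h1 := char_sum_lower D D0.
have h0 : ln D%:R <= ln D.+1%:R :> R by rewrite ler_ln ?posrE ?ltr0n // ler_nat.
have h2 : 2 * B / D%:R <= char_sum chi D.
  rewrite ler_pdivrMr //; move: (le_trans HD (le_trans h0 h1)).
  by rewrite -mulrA [D%:R * _]mulrC; lra.
have := char_sum_diff M0 chi_char chi_sum0 D N DN; rewrite ler_norml => /andP[h3 _].
have h4 : B / D.+1%:R <= B / D%:R :> R.
  rewrite ler_wpM2l ?mulr_ge0 // lef_pV2 ?posrE ?ltr0n // ler_nat //.
have h5 : 2 * B / D%:R = 2 * (B / D%:R) :> R by rewrite [RHS]mulrA.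
by rewrite h5 in h2; move: (_ / D%:R) (_ / D.+1%:R) h2 h3 h4 => x y; lra.
Qed.

(** Multiplied by [char_sum chi N], which is at least delta, the sum is compared with that of chi(k)
    ln k / k. Passing from N / d to N in [char_sum] costs at most B d / N, in total at most 4 B ln 2
    by Chebyshev's bound. *)
Lemma char_mangoldt_sum_bounded : exists C N0,
  forall N, (N0 <= N)%N -> `|char_mangoldt_sum chi N| <= C.
Proof.
have [delta [N0 [delta0 Hdelta]]] := char_sum_away_from_0.
have [C HC] := char_ln_sum_bounded M0 chi_char chi_sum0.
exists ((C + B * (4 * ln 2)) / delta), N0.+1 => N N0N.
rewrite ler_pdivlMr //.
have NR : 0 < N%:R :> R by rewrite ltr0n; apply: leq_ltn_trans N0N.
apply: (@le_trans _ _ `|char_mangoldt_sum chi N * char_sum chi N|).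
  rewrite normrM ler_wpM2l //; apply: le_trans (ler_norm _).
  by apply: Hdelta; apply: ltnW.
have -> : char_mangoldt_sum chi N * char_sum chi N =
  \sum_(1 <= k < N.+1) chi k * (ln k%:R / k%:R) -
  \sum_(1 <= d < N.+1) chi d * von_mangoldt d / d%:R *
     (char_sum chi (N %/ d) - char_sum chi N).
  rewrite (char_sum_mangoldtE chi_char) -sumrB /char_mangoldt_sum mulr_suml.
  by apply: eq_bigr => d _; ring.
apply: le_trans (ler_normB _ _) _; apply: lerD => //.
apply: le_trans (ler_norm_sum _ _ _) _.
apply: (@le_trans _ _ (\sum_(1 <= d < N.+1) von_mangoldt d * (B / N%:R))); last first.
  rewrite -mulr_suml -/(chebyshev_psi N) mulrCA ler_wpM2l ?mulr_ge0 //.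
  by rewrite ler_pdivrMr // mulrC chebyshev_psi_le.
apply: ler_sum_nat => d /andP[d0 dN].
have dR : 0 < d%:R :> R by rewrite ltr0n.
rewrite !normrM (ger0_norm (von_mangoldt_ge0 d)) (ger0_norm (_ : 0 <= d%:R^-1)) ?invr_ge0 //.
rewrite distrC; have := char_sum_diff M0 chi_char chi_sum0 (N %/ d) N (leq_div _ _) => hA.
have hN : B / (N %/ d).+1%:R <= B * (d%:R / N%:R) :> R.
  rewrite ler_wpM2l ?mulr_ge0 // -[leLHS]div1r ler_pdivrMr ?ltr0n //.
  rewrite mulrAC ler_pdivlMr // mul1r -natrM ler_nat mulnC ltnW //.
  by rewrite -ltn_divLR.
have chi1 := char_norm_le1 chi_char d.
have L0 := @von_mangoldt_ge0 R d.
have -> : von_mangoldt d * (B / N%:R) = 1 * von_mangoldt d / d%:R * (B * (d%:R / N%:R)) :> R.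
  by field; rewrite !gt_eqF.
apply: ler_pM => //; rewrite ?mulr_ge0 ?invr_ge0 //; last exact: le_trans hA hN.
by rewrite ler_wpM2r ?invr_ge0 // ler_wpM2r.
Qed.
End NonPrincipal.

(** * The principal character *)

Section Principal.
Context {R : realType} (M : nat) (M0 : (0 < M)%N).

Definition principal_char (k : nat) : R := (coprime k M)%:R.

Lemma principal_char_real : real_char M principal_char.
Proof.
split=> [|a b|a|a]; rewrite /principal_char ?coprime1n ?coprime_modl //.
  by rewrite coprimeMl; do 2! case: coprime; rewrite ?mul0r ?mul1r.
by case: coprime; rewrite !inE eqxx ?orbT.
Qed.

Lemma principal_char_ge0 k : 0 <= principal_char k.
Proof. exact: ler0n. Qed.

(** Only the terms k = M m + 1 are kept, and M m + 1 <= (M + 1) m. *)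
Lemma principal_char_sum_lower n :
  M.+1%:R^-1 * \sum_(1 <= m < n.+1) m%:R^-1 <= char_sum principal_char (M * n + 1).
Proof.
elim: n => [|n IH].
  rewrite big_geq // mulr0; apply: sumr_ge0 => k _.
  by rewrite divr_ge0 // principal_char_ge0.
rewrite big_nat_recr //= mulrDr /char_sum.
rewrite [leRHS](@big_cat_nat _ _ _ (M * n + 1).+1) //=; last first.
  by rewrite ltnS leq_add2r leq_mul2l leqnSn orbT.
apply: lerD => //.
have -> : (M * n.+1 + 1 = (M * n + M).+1)%N by rewrite mulnS addn1 addnC.
rewrite big_nat_recr /=; last by rewrite ltnS leq_add2l.
apply: ler_wpDl.
  by apply: sumr_ge0 => k _; rewrite divr_ge0 // principal_char_ge0.
rewrite /principal_char.
have -> : coprime (M * n + M).+1 M.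
  by rewrite -coprime_modl -mulnSr -addn1 mulnC modnMDl coprime_modl coprime1n.
rewrite -invfM mul1r lef_pV2 ?posrE ?mulr_gt0 ?ltr0n // -natrM ler_nat; nia.
Qed.

Lemma principal_char_sum_unbounded (K : R) : exists N, K < char_sum principal_char N.
Proof.
have [n n0 Hn] := @ln_nat_unbounded R (M.+1%:R * (K + 1)).
exists (M * n + 1)%N; apply: lt_le_trans (principal_char_sum_lower n).
have h : ln n%:R <= \sum_(1 <= m < n.+1) m%:R^-1 :> R.
  apply: le_trans (ln_succ_le n); rewrite ler_ln ?posrE ?ltr0n // ler_nat //.
rewrite mulrC ltr_pdivlMr ?ltr0n //; apply: lt_le_trans h; apply: lt_le_trans Hn.
have MR : 0 < M.+1%:R :> R by rewrite ltr0n.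
by rewrite mulrC ltr_pM2l //; lra.
Qed.

Lemma principal_char_sum_mono m n : (m <= n)%N ->
  char_sum principal_char m <= char_sum principal_char n.
Proof.
move=> mn; rewrite /char_sum [leRHS](@big_cat_nat _ _ _ m.+1) //= lerDl.
by apply: sumr_ge0 => k _; rewrite divr_ge0 // principal_char_ge0.
Qed.

Lemma principal_mangoldt_term_ge0 d :
  0 <= principal_char d * von_mangoldt d / d%:R.
Proof. by rewrite divr_ge0 // mulr_ge0 ?principal_char_ge0 // von_mangoldt_ge0. Qed.

(* If the sum of chi Lambda / d stayed below K, then so would the weighted mean of
   ln k with weights chi(k) / k, although ln k >= 2 K for all large k. *)
Lemma principal_mangoldt_unbounded (K : R) :
  exists N0, forall N, (N0 <= N)%N -> K < char_mangoldt_sum principal_char N.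
Proof.
suff [N0 HN0] : exists N0, K < char_mangoldt_sum principal_char N0.
  exists N0 => N NN; apply: lt_le_trans HN0 _.
  rewrite /char_mangoldt_sum [leRHS](@big_cat_nat _ _ _ N0.+1) //= lerDl.
  by apply: sumr_ge0 => d _; apply: principal_mangoldt_term_ge0.
apply: contrapT => noN.
have T_le N : char_mangoldt_sum principal_char N <= K.
  by rewrite leNgt; apply/negP => h; apply: noN; exists N.
have K0 : 0 <= K.
  by apply: le_trans (T_le 0%N); apply: sumr_ge0 => d _; apply: principal_mangoldt_term_ge0.
have [k0 k00 Hk0] := @ln_nat_unbounded R (2 * K + 1).
(* With x and y the character sums up to N and k0, the two bounds below give (K + 1) x <= (2 K + 1)
   y, against x > 2 (K + 1) y. *)
have [N1 HN1] := principal_char_sum_unbounded (2 * (K + 1) * char_sum principal_char k0).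
pose N := maxn N1 k0.
have big : 2 * (K + 1) * char_sum principal_char k0 < char_sum principal_char N.
  by apply: lt_le_trans HN1 _; apply: principal_char_sum_mono; apply: leq_maxl.
have k0N : (k0 <= N)%N by apply: leq_maxr.
have up : \sum_(1 <= k < N.+1) principal_char k * (ln k%:R / k%:R)
    <= K * char_sum principal_char N.
  rewrite (char_sum_mangoldtE principal_char_real).
  apply: (@le_trans _ _ (char_mangoldt_sum principal_char N * char_sum principal_char N)).
    rewrite /char_mangoldt_sum mulr_suml; apply: ler_sum => d _.
    by rewrite ler_wpM2l ?principal_mangoldt_term_ge0 // principal_char_sum_mono ?leq_div.
  rewrite ler_wpM2r // /char_sum; apply: sumr_ge0 => k _.
  by rewrite divr_ge0 // principal_char_ge0.
have lo : (2 * K + 1) * (char_sum principal_char N - char_sum principal_char k0) <=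
    \sum_(1 <= k < N.+1) principal_char k * (ln k%:R / k%:R).
  rewrite /char_sum [X in X - _](@big_cat_nat _ _ _ k0.+1) //= addrAC subrr add0r.
  rewrite [leRHS](@big_cat_nat _ _ _ k0.+1) //= mulr_sumr -[leLHS]add0r; apply: lerD.
    rewrite big_nat_cond; apply: sumr_ge0 => k /andP[/andP[k1 _] _].
    by rewrite mulr_ge0 ?principal_char_ge0 // divr_ge0 // ln_ge0 // ler1n.
  apply: ler_sum_nat => k /andP[k0k _]; rewrite mulrCA ler_wpM2l ?principal_char_ge0 //.
  rewrite ler_wpM2r ?invr_ge0 //; apply: le_trans Hk0 _.
  have kk := ltn_trans k00 k0k.
  by rewrite ler_ln ?posrE ?ltr0n // ler_nat ltnW.
have c0 : 0 <= char_sum principal_char k0.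
  by apply: sumr_ge0 => k _; rewrite divr_ge0 // principal_char_ge0.
move: (le_trans lo up) big c0 K0.
set x := char_sum _ N; set y := char_sum _ k0 => h1 h2 h3 h4.
have h5 : (K + 1) * x <= (2 * K + 1) * y by move: h1; lra.
have : (K + 1) * (2 * (K + 1) * y) <= (K + 1) * x by rewrite ler_wpM2l //; lra.
have h6 : 0 <= K * y by rewrite mulr_ge0.
have h7 : 0 <= K * K * y by rewrite mulr_ge0 // mulr_ge0.
move=> h8; have : y <= 0 by lra.
move=> y0; have y00 : y = 0 by lra.
move: h2 h5; rewrite y00 !mulr0 => h2.
by rewrite leNgt mulr_gt0 //; lra.
Qed.
End Principal.

(** * Primes at which several characters take given values *)

Section PrimeWithCharacters.
Context {R : realType} (M : nat) (M0 : (0 < M)%N).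
Context {I : finType} {chi : I -> nat -> R}.
Context (chi_real : forall i, real_char M (chi i)).
Context (chi_neq0 : forall i k, coprime k M -> chi i k != 0).

(** These products arise from expanding the product of 1 + eps i chi i over i, restricted to
    residues prime to [M]. *)
Definition subset_char (f : {ffun I -> bool}) (k : nat) : R :=
  principal_char M k * \prod_i (if f i then chi i k else 1).

Lemma char_pm1 i k : coprime k M -> chi i k = 1 \/ chi i k = -1.
Proof.
move=> cop; have := chi_neq0 i k cop; case: (chi_real i) => _ _ _ /(_ k).
by rewrite !inE => /or3P[] /eqP ->; rewrite ?eqxx //; [left|right].
Qed.

Lemma subset_char_real f : real_char M (subset_char f).
Proof.
have [p1 pM pmod prange] := @principal_char_real R M.
rewrite /subset_char; split=> [|a b|a|a].
- rewrite p1 mul1r big1 // => i _; case: (f i) => //.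
  by case: (chi_real i).
- rewrite pM mulrACA -big_split; congr (_ * _); apply: eq_bigr => i _ /=.
  by case: (f i); rewrite ?mulr1 //; case: (chi_real i).
- rewrite pmod; congr (_ * _); apply: eq_bigr => i _.
  by case: (f i) => //; case: (chi_real i).
rewrite /principal_char; case: (boolP (coprime a M)) => [cop|_]; last by rewrite mul0r inE eqxx.
rewrite mul1r; elim/big_rec: _ => [|i x _ IH]; first by rewrite !inE eqxx orbT.
case: (f i); last by rewrite mul1r.
by case: (char_pm1 i a cop) => ->; rewrite ?mul1r ?mulN1r //;
  move: IH; rewrite !inE => /or3P[] /eqP ->; rewrite ?oppr0 ?opprK ?eqxx ?orbT.
Qed.

(** Multiplication by a permutes the residues modulo M and changes the sign of every term. *)
Lemma subset_char_sum0 f a : coprime a M -> subset_char f a = -1 ->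
  \sum_(0 <= k < M) subset_char f k = 0.
Proof.
move=> cop fa; have [_ fM fmod _] := subset_char_real f.
pose h (k : 'I_M) : 'I_M := Ordinal (ltn_pmod (a * k) M0).
have h_inj : injective h.
  have H (x y : 'I_M) : (x <= y)%N -> h x = h y -> x = y.
    move=> xy /(congr1 val) /= /eqP; rewrite eq_sym eqn_mod_dvd ?leq_mul2l ?xy ?orbT //.
    rewrite -mulnBr Gauss_dvdr 1?coprime_sym // => /dvdnP[c Hc].
    by apply: val_inj => /=; have := ltn_ord x; have := ltn_ord y; case: c Hc => [|c]; nia.
  move=> x y hxy; have [xy|yx] := leqP x y; first exact: H.
  by apply/esym/H => //; apply: ltnW.
have : \sum_(0 <= k < M) subset_char f k = - \sum_(0 <= k < M) subset_char f k.
  rewrite {1}big_mkord (reindex_inj h_inj) /= -sumrN big_mkord.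
  by apply: eq_bigr => k _; rewrite fmod fM fa mulN1r.
by lra.
Qed.

(** The product of 1 + eps i chi i(k) detects the k with the prescribed values. If no prime had
    them, then no odd power of a prime would, having the same values as the prime, and no even
    power, where all values are 1 while some eps i is -1. So the sum of [von_mangoldt] k / k with
    this weight would vanish; but on expansion the principal term is unbounded and, by independence,
    all others are bounded. *)
Lemma prime_with_characters (eps : I -> R) :
  (forall i, exists a, [/\ coprime a M, chi i a = -1 &
     forall j, j != i -> chi j a = 1]) ->
  (forall i, eps i = 1 \/ eps i = -1) -> (exists i, eps i = -1) ->
  exists q, [/\ prime q, coprime q M & forall i, chi i q = eps i].
Proof.
move=> indep eps1 [i0 eps_i0]; apply: contrapT => noq.
pose E f : R := \prod_i (if (f : {ffun I -> bool}) i then eps i else 1).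
have kill k : principal_char M k * \prod_i (1 + eps i * chi i k) * von_mangoldt k = 0.
  rewrite /principal_char; case: (boolP (coprime k M)) => [cop|_]; last by rewrite !mul0r.
  have [->|/von_mangoldt_neq0 [p [j [p_pr j0 kE]]]] := eqVneq (von_mangoldt k : R) 0.
    by rewrite mulr0.
  have copp : coprime p M by move: cop; rewrite kE coprime_pexpl.
  have [i Hi] : exists i, chi i k = - eps i.
    have [odd_j|even_j] := boolP (odd j); last first.
      exists i0; rewrite eps_i0 opprK kE (charX (chi_real i0)).
      rewrite -(odd_double_half j) (negbTE even_j) add0n -mul2n exprM.
      by case: (char_pm1 i0 p copp) => ->; rewrite ?sqrrN expr1n ?expr1n.
    apply: contrapT => noi; apply: noq; exists p; split=> // i.
    have chik : chi i k = chi i p.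
      rewrite kE (charX (chi_real i)).
      by case: (char_pm1 i p copp) => ->; rewrite ?expr1n // -signr_odd odd_j expr1.
    rewrite -chik; case: (char_pm1 i k cop) (eps1 i) => e1 [] e2; rewrite e1 e2 //.
      by exfalso; apply: noi; exists i; rewrite e1 e2 opprK.
    by exfalso; apply: noi; exists i; rewrite e1 e2.
  rewrite (bigD1 i) //= Hi.
  have -> : 1 + eps i * - eps i = 0.
    by case: (eps1 i) => ->; ring.
  by rewrite mul0r mulr0 mul0r.
have sumT N : \sum_f E f * char_mangoldt_sum (subset_char f) N = 0.
  rewrite /char_mangoldt_sum; under eq_bigr do rewrite mulr_sumr.
  rewrite exchange_big /= big1 // => k _.
  transitivity (principal_char M k * \prod_i (1 + eps i * chi i k) * von_mangoldt k / k%:R).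
    rewrite [\prod_i _](_ : _ = \prod_i \sum_(b : bool) (if b then eps i * chi i k else 1)).
      rewrite bigA_distr_bigA /= mulr_sumr !mulr_suml; apply: eq_bigr => f _.
      rewrite [\prod_i _](_ : _ = E f * \prod_i (if f i then chi i k else 1)).
        by rewrite /subset_char; ring.
      rewrite /E -big_split; apply: eq_bigr => i _ /=.
      by case: (f i); rewrite ?mulr1.
    by apply: eq_bigr => i _; rewrite big_bool /= addrC.
  by rewrite kill mul0r.
pose f0 : {ffun I -> bool} := [ffun=> false].
have bounded f : exists CN : R * nat, f != f0 ->
    forall N, (CN.2 <= N)%N -> `|char_mangoldt_sum (subset_char f) N| <= CN.1.
  have [->|ff0] := eqVneq f f0; first by exists (0, 0%N).
  have [i fi] : exists i, f i.
    apply: contrapT => nof; move/eqP: ff0; apply; apply/ffunP => i; rewrite ffunE.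
    by apply/negbTE/negP => fi; apply: nof; exists i.
  have [a [copa chia chija]] := indep i.
  have fa : subset_char f a = -1.
    rewrite /subset_char /principal_char copa mul1r (bigD1 i) //= fi chia big1 ?mulr1 //.
    by move=> j ji; case: (f j) => //; apply: chija.
  have [C [N0 H]] := char_mangoldt_sum_bounded M0 (subset_char_real f)
    (subset_char_sum0 f a copa fa).
  by exists (C, N0).
have [CN HCN] := fin_all_exists bounded.
pose N0 := (\max_f (CN f).2)%N.
have E1 f : `|E f| = 1.
  rewrite /E normr_prod big1 // => i _; case: (f i); rewrite ?normr1 //.
  by case: (eps1 i) => ->; rewrite ?normrN normr1.
have [N1 HN1] := @principal_mangoldt_unbounded R M M0 (\sum_(f | f != f0) (CN f).1).
pose N := maxn N0 N1.
have := sumT N; rewrite (bigD1 f0) //= => /eqP; rewrite addr_eq0 => /eqP Hsum.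
have f0E : char_mangoldt_sum (subset_char f0) N = char_mangoldt_sum (principal_char M) N.
  apply: eq_bigr => k _; congr (_ * _ / _); rewrite /subset_char big1 ?mulr1 // => i _.
  by rewrite ffunE.
have E0 : E f0 = 1 by rewrite /E big1 // => i _; rewrite ffunE.
move: Hsum; rewrite E0 mul1r f0E => Hsum.
have := HN1 N (leq_maxr _ _); rewrite Hsum ltNge => /negP; apply.
apply: le_trans (ler_norm _) _; rewrite normrN; apply: le_trans (ler_norm_sum _ _ _) _.
apply: ler_sum => f ff0; rewrite normrM E1 mul1r; apply: HCN => //.
by apply: leq_trans (leq_maxl _ _); apply: (leq_bigmax f).
Qed.
End PrimeWithCharacters.

(** * Sums of three squares *)

Definition squarefree (n : nat) := forall p, prime p -> ~~ (p ^ 2 %| n)%N.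

Lemma squarefree_dvd m n : (m %| n)%N -> squarefree n -> squarefree m.
Proof. by move=> mn sq p /sq; apply: contra => /dvdn_trans; apply. Qed.

Lemma squarefree_pdiv_coprime p m : prime p -> squarefree (p * m) -> coprime p m.
Proof.
move=> p_pr sq; rewrite prime_coprime //; apply: contra (sq p p_pr) => pm.
by rewrite expnS expn1 dvdn_pmul2l // prime_gt0.
Qed.

Lemma dvdz_sqrD_congr (d r r0 : nat) (c : int) : r = r0 %[mod d] ->
  (d%:Z %| r0%:Z ^+ 2 + c)%Z -> (d%:Z %| r%:Z ^+ 2 + c)%Z.
Proof.
move=> rr0 h; have -> : r%:Z ^+ 2 + c = (r%:Z - r0%:Z) * (r%:Z + r0%:Z) + (r0%:Z ^+ 2 + c) by ring.
apply: rpredD => //; apply: dvdz_mulr.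
by rewrite -eqz_mod_dvd !modz_nat rr0.
Qed.

Lemma sqrD_crt (n : nat) (c : int) : (0 < n)%N -> squarefree n ->
  (forall p, prime p -> (p %| n)%N -> exists r : nat, (p%:Z %| r%:Z ^+ 2 + c)%Z) ->
  exists r : nat, (n%:Z %| r%:Z ^+ 2 + c)%Z.
Proof.
elim/ltn_ind: n => n IH n0 sq H; have [n1|n1] := leqP n 1.
  by exists 0%N; have -> : n = 1%N by lia; rewrite dvd1z.
have p_pr := pdiv_prime n1; have /dvdnP[m nE] := pdiv_dvd n.
move: (pdiv n) p_pr nE => p p_pr; rewrite mulnC => nE.
have p0 := prime_gt0 p_pr.
have m0 : (0 < m)%N by move: n0; rewrite nE muln_gt0 => /andP[].
have cop : coprime p m by apply: squarefree_pdiv_coprime => //; rewrite -nE.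
have [r1 Hr1] : exists r : nat, (m%:Z %| r%:Z ^+ 2 + c)%Z.
  apply: IH => //; first by rewrite nE ltn_Pmull // prime_gt1.
    by apply: squarefree_dvd sq; rewrite nE dvdn_mull.
  by move=> q q_pr qm; apply: H => //; rewrite nE dvdn_mull.
have [r0 Hr0] : exists r : nat, (p%:Z %| r%:Z ^+ 2 + c)%Z.
  by apply: H => //; rewrite nE dvdn_mulr.
exists (chinese p m r0 r1); rewrite nE PoszM Gauss_dvdz //; apply/andP; split.
  exact: dvdz_sqrD_congr (chinese_modl cop r0 r1) Hr0.
exact: dvdz_sqrD_congr (chinese_modr cop r0 r1) Hr1.
Qed.

Lemma squarefree_mult (F : nat -> int) (n : nat) : (0 < n)%N -> squarefree n ->
  F 1%N = 1 -> (forall a b, F (a * b)%N = F a * F b) ->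
  F n = \prod_(p <- primes n) F p.
Proof.
move=> n0 sq F1 FM; elim/ltn_ind: n n0 sq => n IH n0 sq; have [n1|n1] := leqP n 1.
  have -> : n = 1%N by lia.
  by rewrite F1 big_nil.
have p_pr := pdiv_prime n1; have /dvdnP[m nE] := pdiv_dvd n.
move: (pdiv n) p_pr nE => p p_pr; rewrite mulnC => nE.
have p0 := prime_gt0 p_pr.
have m0 : (0 < m)%N by move: n0; rewrite nE muln_gt0 => /andP[].
have cop : coprime p m by apply: squarefree_pdiv_coprime => //; rewrite -nE.
have mn : (m < n)%N by rewrite nE ltn_Pmull // prime_gt1.
have sqm : squarefree m by apply: squarefree_dvd sq; rewrite nE dvdn_mull.
rewrite nE FM (perm_big (p :: primes m)) /=; last first.
  apply: uniq_perm; rewrite /= ?primes_uniq ?andbT //.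
    by rewrite mem_primes p_pr m0 /= -prime_coprime.
  by move=> r; rewrite primesM // primes_prime // !inE.
by rewrite big_cons (IH m mn m0 sqm).
Qed.

(** [chi4] and [chi8] are the Jacobi symbols (-1 / k) and (2 / k), set to 0 at even k. *)
Definition chi4 (k : nat) : int := if odd k then (if (k %% 4 == 1)%N then 1 else -1) else 0.
Definition chi8 (k : nat) : int :=
  if odd k then (if ((k %% 8 == 1) || (k %% 8 == 7))%N then 1 else -1) else 0.

Lemma chi4M a b : chi4 (a * b) = chi4 a * chi4 b.
Proof.
have E k : chi4 k = chi4 (k %% 4) by rewrite /chi4 modn_mod; congr (if _ then _ else _); lia.
rewrite E -modnMm (E a) (E b).
have := ltn_pmod a (isT : 0 < 4)%N; have := ltn_pmod b (isT : 0 < 4)%N.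
by move: (a %% 4)%N (b %% 4)%N => [|[|[|[|i]]]] [|[|[|[|j]]]].
Qed.

Lemma chi8M a b : chi8 (a * b) = chi8 a * chi8 b.
Proof.
have E k : chi8 k = chi8 (k %% 8) by rewrite /chi8 modn_mod; congr (if _ then _ else _); lia.
rewrite E -modnMm (E a) (E b).
have := ltn_pmod a (isT : 0 < 8)%N; have := ltn_pmod b (isT : 0 < 8)%N.
by move: (a %% 8)%N (b %% 8)%N => [|[|[|[|[|[|[|[|i]]]]]]]] [|[|[|[|[|[|[|[|j]]]]]]]].
Qed.

Lemma legendre_N1_chi4 p : prime p -> (2 < p)%N -> legendre p p.-1 = chi4 p.
Proof.
move=> p_pr p2; rewrite legendre_N1 // /chi4 prime_gt2_odd // -signr_odd.
have := prime_gt2_odd p_pr p2; case: ifP => h p_odd.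
  by have -> : odd p.-1./2 = false by lia.
by have -> : odd p.-1./2 by lia.
Qed.

Lemma legendre_2_chi8 p : prime p -> (2 < p)%N -> legendre p 2 = chi8 p.
Proof.
move=> p_pr p2; rewrite legendre_2 // /chi8 prime_gt2_odd // -signr_odd.
have := prime_gt2_odd p_pr p2; case: ifP => h p_odd.
  by have -> : odd (uphalf p.-1./2) = false by lia.
by have -> : odd (uphalf p.-1./2) by lia.
Qed.

(** * The auxiliary prime [q] *)

Section AuxiliaryPrime.
Context (R : realType) (m : nat) (m0 : (0 < m)%N) (m_odd : odd m) (m_sq : squarefree m).

(* The tags 4 and 8 stand for the characters of conductor 4 and 8. *)
Definition tag_char (t k : nat) : int :=
  if t == 4 then chi4 k else if t == 8 then chi8 k else legendre t k.

Let tags := [:: 4, 8 & primes m]%N.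

Lemma tag_odd_prime t : t \in primes m -> [/\ prime t, (2 < t)%N, t != 4, t != 8 & (t %| m)%N].
Proof.
rewrite mem_primes => /and3P[t_pr _ tm]; split=> //.
- by rewrite ltn_neqAle prime_gt1 // andbT; apply/eqP => t2; move: tm; rewrite -t2 dvdn2 m_odd.
- by apply: contraTneq t_pr => ->.
- by apply: contraTneq t_pr => ->.
Qed.

Lemma coprime8M k : coprime k (8 * m) = odd k && coprime k m.
Proof. by rewrite coprimeMr (coprime_pexpr k 2 (isT : 0 < 3)%N) coprimen2. Qed.

Lemma tag_char_real t : t \in tags -> real_char (8 * m) (fun k => (tag_char t k)%:~R : R).
Proof.
have mod_dvd d k : (d %| 8)%N -> (k %% (8 * m) = k %[mod d])%N.
  by move=> d8; apply: modn_dvdm; apply: dvdn_mulr.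
have odd_mod k : odd (k %% (8 * m)) = odd k.
  by have := mod_dvd 2%N k isT; rewrite !modn2; do 2! case: odd.
have chi4_mod k : chi4 (k %% (8 * m)) = chi4 k by rewrite /chi4 odd_mod mod_dvd.
have chi8_mod k : chi8 (k %% (8 * m)) = chi8 k by rewrite /chi8 odd_mod mod_dvd.
have H (F : nat -> int) : F 1%N = 1 -> (forall a b, F (a * b)%N = F a * F b) ->
    (forall k, F (k %% (8 * m))%N = F k) -> (forall k, F k \in [:: 0; 1; -1]) ->
    real_char (8 * m) (fun k => (F k)%:~R : R).
  move=> F1 FM Fmod Fr; split=> [|a b|a|a].
  - by rewrite F1.
  - by rewrite FM rmorphM.
  - by rewrite Fmod.
  by have := Fr a; rewrite !inE => /or3P[] /eqP ->; rewrite ?rmorph0 ?rmorph1 ?rmorphN1 eqxx ?orbT.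
rewrite !inE => /or3P[/eqP ->|/eqP ->|/tag_odd_prime [t_pr t2 t4 t8 tm]]; apply: H => //.
- exact: chi4M.
- by move=> k; rewrite /tag_char /= /chi4; case: ifP => // _; case: ifP.
- exact: chi8M.
- by move=> k; rewrite /tag_char /= /chi8; case: ifP => // _; case: ifP.
- by rewrite /tag_char (negbTE t4) (negbTE t8) /legendre quad_char1.
- by move=> a b; rewrite /tag_char (negbTE t4) (negbTE t8) legendreM.
- move=> k; rewrite /tag_char (negbTE t4) (negbTE t8) -(legendre_mod t_pr (k %% _)%N).
  by rewrite modn_dvdm ?dvdn_mull // legendre_mod.
by move=> k; rewrite /tag_char (negbTE t4) (negbTE t8); apply: legendre_range.
Qed.

Lemma tag_char_neq0 t k : t \in tags -> coprime k (8 * m) -> tag_char t k != 0.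
Proof.
rewrite coprime8M => tL /andP[k_odd copk]; move: tL; rewrite !inE.
case/or3P=> [/eqP ->|/eqP ->|/tag_odd_prime [t_pr t2 t4 t8 tm]].
- by rewrite /tag_char /chi4 k_odd /=; case: ifP.
- by rewrite /tag_char /chi8 k_odd /=; case: ifP.
rewrite /tag_char (negbTE t4) (negbTE t8) legendre_eq0 // -prime_coprime //.
by rewrite coprime_sym; apply: coprime_dvdr copk.
Qed.

Lemma legendre_one_mod p k : prime p -> (k = 1 %[mod p])%N -> legendre p k = 1.
Proof. by move=> p_pr k1; rewrite -legendre_mod // k1 legendre_mod // /legendre quad_char1. Qed.

(** Chinese remainders: 7 modulo 8 makes [chi4] alone negative, 5 modulo 8 [chi8] alone, both with 1
    modulo m; for a prime t, a nonresidue modulo t is combined with 1 modulo 8 m / t. *)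
Lemma tag_char_indep t : t \in tags -> exists a, [/\ coprime a (8 * m), tag_char t a = -1 &
  forall s, s \in tags -> s != t -> tag_char s a = 1].
Proof.
have cop8 : coprime 8 m by rewrite (coprime_pexpl 2 m (isT : 0 < 3)%N) coprime2n.
have L1 p k : p \in primes m -> (k = 1 %[mod m])%N -> tag_char p k = 1.
  move=> /tag_odd_prime [p_pr _ p4 p8 pm] k1; rewrite /tag_char (negbTE p4) (negbTE p8).
  by apply: legendre_one_mod => //; rewrite -(modn_dvdm k pm) k1 modn_dvdm.
have copm k : (k = 1 %[mod m])%N -> coprime k m.
  by move=> k1; rewrite -coprime_modl k1 coprime_modl coprime1n.
have two r : let a := chinese 8 m r 1 in (a %% 8 = r %% 8)%N /\ (a = 1 %[mod m])%N.
  by split; [apply: chinese_modl|apply: chinese_modr].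
rewrite !inE => /or3P[/eqP ->|/eqP ->|tm].
- have [a8 a1] := two 7; exists (chinese 8 m 7 1); move: (chinese _ _ _ _) a8 a1 => a a8 a1.
  split; first by rewrite coprime8M copm // andbT; lia.
    by rewrite /tag_char /chi4 /= ifT ?ifF //; lia.
  move=> s; rewrite !inE => /or3P[/eqP ->//|/eqP -> _|sm _]; last exact: L1.
  by rewrite /tag_char /chi8 /= ifT ?ifT //; lia.
- have [a8 a1] := two 5; exists (chinese 8 m 5 1); move: (chinese _ _ _ _) a8 a1 => a a8 a1.
  split; first by rewrite coprime8M copm // andbT; lia.
    by rewrite /tag_char /chi8 /= ifT ?ifF //; lia.
  move=> s; rewrite !inE => /or3P[/eqP -> _|/eqP ->//|sm _]; last exact: L1.
  by rewrite /tag_char /chi4 /= ifT ?ifT //; lia.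
have [t_pr t2 t4 t8 tdm] := tag_odd_prime t tm.
have [g Hg] := legendre_nonresidue t_pr t2.
have [c mE] : exists c, m = (t * c)%N by case/dvdnP: tdm => c ->; exists c; rewrite mulnC.
have copt : coprime t c by apply: squarefree_pdiv_coprime => //; rewrite -mE.
have copt8 : coprime t (8 * c).
  by rewrite coprimeMr copt andbT (coprime_pexpr t 2 (isT : 0 < 3)%N) coprimen2 prime_gt2_odd.
pose a := chinese t (8 * c) g 1.
have at_ : (a = g %[mod t])%N by apply: chinese_modl.
have a8c : (a = 1 %[mod 8 * c])%N by apply: chinese_modr.
clearbody a.
have lta : legendre t a = -1 by rewrite -legendre_mod // at_ legendre_mod.
have a8 : (a %% 8 = 1)%N by rewrite -(modn_dvdm a (dvdn_mulr c (dvdnn 8))) a8c modn_dvdm ?dvdn_mulr.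
have a1c : (a = 1 %[mod c])%N.
  by rewrite -(modn_dvdm a (dvdn_mull 8 (dvdnn c))) a8c modn_dvdm ?dvdn_mull.
have a_odd : odd a by clear -a8; lia.
have a4 : (a %% 4 = 1)%N by clear -a8; lia.
exists a; split.
- rewrite coprime8M mE coprimeMr; apply/and3P; split=> //.
    by rewrite coprime_sym prime_coprime // -legendre_eq0 // lta.
  by rewrite -coprime_modl a1c coprime_modl coprime1n.
- by rewrite /tag_char (negbTE t4) (negbTE t8).
move=> s; rewrite !inE => /or3P[/eqP -> _|/eqP -> _|sm st].
- by rewrite /tag_char /chi4 /= a_odd a4.
- by rewrite /tag_char /chi8 /= a_odd a8.
have [s_pr _ s4 s8 sdm] := tag_odd_prime s sm.
rewrite /tag_char (negbTE s4) (negbTE s8); apply: legendre_one_mod => //.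
have sc : (s %| c)%N.
  move: sdm; rewrite mE Gauss_dvdr // prime_coprime // dvdn_prime2 //.
by rewrite -(modn_dvdm a sc) a1c modn_dvdm.
Qed.

(** If all signs are 1, then q = 1 will do; otherwise some sign is -1, as [prime_with_characters]
    demands. The sign 1 at the tag 4 means q = 1 modulo 4. *)
Lemma auxiliary_prime (delta : int) (eps : nat -> int) :
  delta \in [:: 1; -1] -> (forall p, p \in primes m -> eps p \in [:: 1; -1]) ->
  exists q, [/\ q = 1%N \/ prime q, coprime q (8 * m), (q %% 4 = 1)%N, chi8 q = delta &
    forall p, p \in primes m -> legendre p q = eps p].
Proof.
move=> delta1 eps1.
pose epst t := if t == 4 then 1 else if t == 8 then delta else eps t.
have epst1 t : t \in tags -> epst t \in [:: 1; -1].
  rewrite !inE => /or3P[/eqP ->//|/eqP ->|tm]; first by rewrite /epst /= !inE in delta1 *.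
  by have [_ _ t4 t8 _] := tag_odd_prime t tm; have := eps1 t tm;
    rewrite /epst (negbTE t4) (negbTE t8) !inE.
have finish q : q = 1%N \/ prime q -> coprime q (8 * m) ->
    (forall t, t \in tags -> tag_char t q = epst t) ->
    [/\ q = 1%N \/ prime q, coprime q (8 * m), (q %% 4 = 1)%N, chi8 q = delta &
     forall p, p \in primes m -> legendre p q = eps p].
  move=> q1 copq H; split=> //.
  - have := H 4%N; rewrite /tag_char /epst /= inE eqxx => /(_ isT).
    by rewrite /chi4; case: ifP => // _; case: eqP.
  - by have := H 8%N; rewrite /tag_char /epst /= !inE eqxx orbT => /(_ isT).
  move=> p pm; have := H p; rewrite !inE pm !orbT => /(_ isT).
  by have [_ _ p4 p8 _] := tag_odd_prime p pm; rewrite /tag_char /epst (negbTE p4) (negbTE p8).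
have [all1|] := boolP (all (fun t => epst t == 1) tags).
  exists 1%N; apply: finish; [by left|exact: coprime1n|].
  move=> t tL; rewrite (eqP (allP all1 t tL)); move: tL; rewrite !inE.
  case/or3P=> [/eqP ->|/eqP ->|/tag_odd_prime [t_pr _ t4 t8 _]] //.
  by rewrite /tag_char (negbTE t4) (negbTE t8) legendre_one_mod.
rewrite -has_predC => /hasP[t0 t0L /= t0N1].
have M0 : (0 < 8 * m)%N by rewrite muln_gt0.
pose I : finType := seq_sub tags.
pose chi (i : I) k : R := (tag_char (ssval i) k)%:~R.
have chi_real i : real_char (8 * m) (chi i) by apply: tag_char_real; apply: ssvalP.
have chi_neq0 i k : coprime k (8 * m) -> chi i k != 0.
  by rewrite intr_eq0; apply: tag_char_neq0; apply: ssvalP.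
have [|||q [q_pr copq Hq]] := prime_with_characters _ M0 chi_real chi_neq0
    (fun i => (epst (ssval i))%:~R).
- move=> i; have [a [copa ta sa]] := tag_char_indep (ssval i) (ssvalP i).
  exists a; split=> //; first by rewrite /chi ta.
  by move=> j ji; rewrite /chi sa //; apply: ssvalP.
- move=> i; have := epst1 (ssval i) (ssvalP i); rewrite !inE.
  by case/orP=> /eqP ->; [left|right].
- exists (SeqSub t0L) => /=; have := epst1 t0 t0L; rewrite !inE (negbTE t0N1).
  by move=> /eqP ->.
exists q; apply: finish => //; first by right.
by move=> t tL; have /intr_inj := Hq (SeqSub tL).
Qed.
End AuxiliaryPrime.

Definition three_squares (n : nat) := exists x y z : int, n%:Z = x ^+ 2 + y ^+ 2 + z ^+ 2.

Lemma legendre_dvd_sqr p (c : int) k : prime p -> (2 < p)%N -> legendre p k = 1 ->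
  (p%:Z %| k%:Z + c)%Z -> exists r : nat, (p%:Z %| r%:Z ^+ 2 + c)%Z.
Proof.
move=> p_pr p2 /(legendre_sqr p_pr p2) [s Hs] kc; exists s.
have -> : s%:Z ^+ 2 + c = ((s ^ 2)%N%:Z - k%:Z) + (k%:Z + c).
  by rewrite expnS expn1 PoszM; ring.
by apply: rpredD => //; rewrite -eqz_mod_dvd !modz_nat Hs.
Qed.

Lemma chi4_sqr k : odd k -> chi4 k * chi4 k = 1.
Proof. by rewrite /chi4 => ->; case: ifP. Qed.

(* With d = 2 if n = 3 mod 8 and d = 1 otherwise, the signs prescribed for the prime q
   make - d q a square modulo n; reciprocity then makes n a square modulo q. *)
Lemma three_squares_squarefree (R : realType) n : (0 < n)%N -> squarefree n ->
  (n %% 8 != 7)%N -> three_squares n.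
Proof.
move=> n0 sq n7.
have n4 : ~~ (4 %| n)%N := sq 2%N isT.
pose m := if odd n then n else n./2.
have m_odd : odd m.
  by rewrite /m; case: ifP => // n_even; clear -n4 n_even; lia.
have nE : n = (if odd n then m else 2 * m)%N.
  rewrite /m; case: (boolP (odd n)) => // n_even.
  by rewrite -{1}(odd_double_half n) (negbTE n_even) mul2n.
have m0 : (0 < m)%N by case: (m) m_odd.
have mn : (m %| n)%N by rewrite {1}nE; case: ifP => _; rewrite ?dvdn_mull.
have m_sq : squarefree m := squarefree_dvd _ _ mn sq.
pose d := if (n %% 8 == 3)%N then 2%N else 1%N.
(* For n = 2 m this value of (2 / q) will cancel (m / q) = [chi4 m]. *)
pose delta : int := if odd n then 1 else chi4 m.
have odd_p p : p \in primes m -> prime p /\ (2 < p)%N.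
  by move=> /(tag_odd_prime m m_odd) [].
(* [p.-1 * d] stands for - d: if q has the same symbol modulo p as - d, then - d q is a square
   modulo p. *)
have eps_pm p : p \in primes m -> legendre p (p.-1 * d) \in [:: 1; -1].
  move=> pm; have [p_pr p2] := odd_p p pm; have p_odd := prime_gt2_odd p_pr p2.
  rewrite legendreM // legendre_N1_chi4 // /d; case: ifP => _.
    by rewrite legendre_2_chi8 // /chi4 /chi8 p_odd; do 2! case: ifP.
  by rewrite /legendre quad_char1 mulr1 /chi4 p_odd; case: ifP.
have delta_pm : delta \in [:: 1; -1].
  by rewrite /delta /chi4 m_odd; case: ifP => _ //; case: ifP.
have [q [q1 copq q4 q8 qm]] := @auxiliary_prime R m m0 m_odd m_sq delta
    (fun p => legendre p (p.-1 * d)) delta_pm eps_pm.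
have [q_odd copqm] : odd q /\ coprime q m by move: copq; rewrite coprime8M => /andP.
have q0 : (0 < q)%N by case: (q) q_odd.
have dodd : d = 2%N -> odd n by rewrite /d; case: eqP => // ? _; lia.
have copq_n : coprime q n.
  rewrite nE; case: ifP => // _; by rewrite coprimeMr copqm coprimen2 q_odd.
have q2 : prime q -> (2 < q)%N by move=> q_pr; move: (prime_gt1 q_pr); clear -q4; lia.
have d12 : d = 1%N \/ d = 2%N by rewrite /d; case: ifP; [right|left].
have cop : coprime n (d * q).
  rewrite coprimeMr [coprime n q]coprime_sym copq_n andbT.
  by case: d12 dodd => -> H; [exact: coprimen1|rewrite coprimen2 H].
have Q_sq : squarefree (d * q).
  move=> p p_pr; apply/negP => ppQ.
  have pQ : (p %| d * q)%N by apply: dvdn_trans ppQ; rewrite expnS dvdn_mulr.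
  case: q1 => [q1|q_pr].
    move: ppQ pQ; rewrite q1 muln1; case: d12 => ->.
      by rewrite !dvdn1 => _ /eqP p1; rewrite p1 in p_pr.
    by move=> /(@dvdn_leq _ 2 isT) h; have := prime_gt1 p_pr; nia.
  have [p2|p2] := eqVneq p 2%N.
    move: ppQ; rewrite p2; case: d12 => ->; last first.
      by rewrite -[(2 ^ 2)%N]/(2 * 2)%N dvdn_pmul2l // dvdn2 q_odd.
    by rewrite mul1n => /(dvdn_trans (isT : 2 %| 2 ^ 2)%N); rewrite dvdn2 q_odd.
  have pd : coprime (p ^ 2) d.
    rewrite coprime_pexpl //; case: d12 => ->; rewrite ?coprimen1 // coprimen2.
    by case: (even_prime p_pr) => // pe; rewrite pe in p2.
  move: ppQ; rewrite Gauss_dvdr // => ppq.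
  have /eqP pq : p == q by rewrite -dvdn_prime2 //; apply: dvdn_trans ppq; rewrite expnS dvdn_mulr.
  by have := dvdn_leq q0 ppq; rewrite pq; have := prime_gt1 q_pr; nia.
have [r Hr] : exists r : nat, (n%:Z %| r%:Z ^+ 2 + (d * q)%:Z)%Z.
  apply: sqrD_crt => // p p_pr pn.
  have [p2|p2] := eqVneq p 2%N.
    exists (odd (d * q) : nat); rewrite p2.
    by case: (odd (d * q)) (odd_double_half (d * q)) => /=; lia.
  have pm : p \in primes m.
    rewrite mem_primes p_pr m0; move: pn; rewrite {1}nE; case: ifP => // _.
    by rewrite Euclid_dvdM // dvdn_prime2 // (negbTE p2).
  have [_ p3] := odd_p p pm.
  apply: (@legendre_dvd_sqr p _ (p.-1 * d * q)%N) => //.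
    rewrite legendreM // qm //; have := eps_pm p pm.
    by rewrite !inE => /orP[] /eqP ->.
  have -> : (p.-1 * d * q)%N%:Z + (d * q)%N%:Z = p%:Z * (d * q)%N%:Z.
    by rewrite -PoszD -PoszM -mulnA -mulSnr prednK ?prime_gt0.
  exact: dvdz_mulr.
have [s Hs] : exists s : nat, ((d * q)%:Z %| s%:Z ^+ 2 - n%:Z)%Z.
  apply: sqrD_crt => //; first by rewrite muln_gt0 q0; case: d12 => ->.
  move=> p p_pr pQ; have [p2|p2] := eqVneq p 2%N.
    by exists (odd n : nat); rewrite p2; case: (odd n) (odd_double_half n) => /=; lia.
  have pq : (p %| q)%N.
    move: pQ; rewrite Euclid_dvdM //; case: d12 => ->.
      by rewrite dvdn1 => /orP[/eqP p1|//]; rewrite p1 in p_pr.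
    by rewrite dvdn_prime2 // (negbTE p2).
  case: q1 => [q1|q_pr]; first by move: pq p_pr; rewrite q1 dvdn1 => /eqP ->.
  have {pq} /eqP pq : p == q by rewrite -dvdn_prime2.
  rewrite {p p_pr pQ p2}pq; have q3 := q2 q_pr.
  apply: (@legendre_dvd_sqr q _ n) => //; last by rewrite subrr.
  (* Reciprocity turns each (p / q) into (q / p), which was prescribed as (- d / p). *)
  have Lm : legendre q m = \prod_(p <- primes m) legendre p (p.-1 * d).
    rewrite (squarefree_mult (legendre q)) //; first last.
    - by move=> a b; rewrite legendreM.
    - by rewrite /legendre quad_char1.
    apply: eq_big_seq => p pm; rewrite -qm //; have [p_pr p3] := odd_p p pm.
    rewrite [RHS]quadratic_reciprocity //; apply: contraTneq copqm => <-.
    by rewrite prime_coprime // negbK; move: pm; rewrite mem_primes => /and3P[].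
  have Lm4 : \prod_(p <- primes m) legendre p p.-1 = chi4 m.
    rewrite (squarefree_mult chi4) //; last exact: chi4M.
    by apply: eq_big_seq => p pm; have [p_pr p3] := odd_p p pm; rewrite legendre_N1_chi4.
  have Lm8 : \prod_(p <- primes m) legendre p 2 = chi8 m.
    rewrite (squarefree_mult chi8) //; last exact: chi8M.
    by apply: eq_big_seq => p pm; have [p_pr p3] := odd_p p pm; rewrite legendre_2_chi8.
  have {}Lm : legendre q m = chi4 m * (if d == 2%N then chi8 m else 1).
    rewrite Lm -Lm4; case: d12 => -> /=.
      by rewrite mulr1; apply: eq_bigr => p _; rewrite muln1.
    rewrite -Lm8 -big_split; apply: eq_big_seq => p pm /=.
    by have [p_pr p3] := odd_p p pm; rewrite legendreM.
  (* For odd n: if n is 1 or 5 modulo 8, then [chi4 n] is 1; if n is 3, both characters are -1 and d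
     = 2 makes the product 1. For n = 7 either choice of d would give -1. *)
  rewrite nE; case: ifP => n_odd.
    rewrite Lm /d; move: nE; rewrite n_odd => nm; rewrite -nm.
    case: (boolP (n %% 8 == 3)%N) => n3 /=; rewrite /chi4 /chi8 n_odd.
      have -> : (n %% 4 == 1)%N = false by clear -n3; lia.
      by rewrite (eqP n3).
    by have -> : (n %% 4 == 1)%N by clear -n3 n7 n_odd; lia.
  rewrite legendreM // legendre_2_chi8 // q8 /delta n_odd Lm /d.
  have -> : (n %% 8 == 3)%N = false by clear -n_odd; lia.
  by rewrite mulr1 chi4_sqr.
have [u [v [t [t0 Ht]]]] : exists u v t : int, t != 0 /\ (d * q)%:Z * t ^+ 2 = u ^+ 2 + v ^+ 2.
  have [u [v [t [t0 Ht]]]] : exists u v t : int, t != 0 /\ q%:Z * t ^+ 2 = u ^+ 2 + v ^+ 2.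
    case: q1 => [->|q_pr]; first by exists 1, 0, 1.
    have q3 := q2 q_pr.
    have H1 : legendre q q.-1 = 1 by rewrite legendre_N1_chi4 // /chi4 q_odd q4.
    have H2 : (q%:Z %| q.-1%:Z + 1)%Z by rewrite -PoszD addn1 prednK.
    have [r' Hr'] := @legendre_dvd_sqr q 1 q.-1 q_pr q3 H1 H2.
    exact: prime_two_squares q0 Hr'.
  case: d12 => ->; first by exists u, v, t; rewrite mul1n.
  exists (u + v), (u - v), t; split=> //.
  by rewrite PoszM -mulrA Ht; ring.
have Q0 : (0 < d * q)%N by rewrite muln_gt0 q0; case: d12 => ->.
exact: three_squares_of_legendre n0 Q0 cop Hs Hr t0 Ht.
Qed.

Lemma three_squares_scale k n : three_squares n -> three_squares (k ^ 2 * n).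
Proof.
case=> x [y [z E]]; exists (k%:Z * x), (k%:Z * y), (k%:Z * z).
by rewrite PoszM E expnS expn1 PoszM; ring.
Qed.

(** Square factors p^2 are split off: p is odd as 4 does not divide n, so p^2 = 1 modulo 8 and both
    hypotheses pass to the quotient. *)
Theorem three_squares_thm (R : realType) n : ~~ (4 %| n)%N -> (n %% 8 != 7)%N ->
  three_squares n.
Proof.
elim/ltn_ind: n => n IH n4 n7; have [n0|n0] := posnP n; first by rewrite n0 in n4.
have [sq|] := pselect (squarefree n); first exact: (three_squares_squarefree R).
move=> /existsNP[p] /not_implyP[p_pr] /negP; rewrite negbK => /dvdnP[k nE].
have p2 : p != 2%N by apply: contra n4 => /eqP p2; rewrite nE p2 dvdn_mull.
have p8 : (p ^ 2 %% 8 = 1)%N.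
  have : odd p by case: (even_prime p_pr) => // pe; rewrite pe in p2.
  clear; rewrite -modnXm => p_odd.
  have : (p %% 8 \in [:: 1; 3; 5; 7])%N by rewrite !inE; lia.
  by rewrite !inE => /or4P[] /eqP ->.
rewrite nE mulnC; apply: three_squares_scale; apply: IH.
- move: n0; rewrite {1}nE => n0; rewrite nE ltn_Pmulr //.
    by rewrite -(exp1n 2) ltn_exp2r // prime_gt1.
  by move: n0; rewrite muln_gt0 => /andP[].
- by apply: contra n4 => h; rewrite nE dvdn_mulr.
by apply: contra n7; rewrite nE -modnMm p8 muln1 modn_mod.
Qed.

(** Squares are 0 or 1 modulo 4, so x, y and z are all even. *)
Lemma three_squares_4 n : three_squares (4 * n) -> three_squares n.
Proof.
case=> x [y [z E]].
have even (a : int) : exists b, a = 2 * b \/ a = 2 * b + 1.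
  by exists (a %/ 2)%Z; have := divz_eq a 2; have := modz_ge0 a (isT : 2 != 0 :> int);
     have := @ltz_pmod a 2 isT; lia.
have [u Hu] := even x; have [v Hv] := even y; have [w Hw] := even z.
exists u, v, w; rewrite PoszM in E.
case: Hu E => ->; case: Hv => ->; case: Hw => ->; lia.
Qed.

Lemma not_three_squares_7 n : (n %% 8 = 7)%N -> ~ three_squares n.
Proof.
move=> n7 [x [y [z E]]].
have sq (a : int) : exists k, [\/ a ^+ 2 = 8 * k, a ^+ 2 = 8 * k + 1 | a ^+ 2 = 8 * k + 4].
  have [c [r [-> r4]]] : exists c r : int, a = 4 * c + r /\ r \in [:: 0; 1; 2; 3].
    exists (a %/ 4)%Z, (a %% 4)%Z; rewrite !inE; have := divz_eq a 4.
    have := modz_ge0 a (isT : 4 != 0 :> int); have := @ltz_pmod a 4 isT; lia.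
  move: r4; rewrite !inE => /or4P[] /eqP ->.
  - by exists (2 * c ^+ 2); constructor 1; ring.
  - by exists (2 * c ^+ 2 + c); constructor 2; ring.
  - by exists (2 * c ^+ 2 + 2 * c); constructor 3; ring.
  - by exists (2 * c ^+ 2 + 3 * c + 1); constructor 2; ring.
have [i Hi] := sq x; have [j Hj] := sq y; have [l Hl] := sq z.
move: (x ^+ 2) (y ^+ 2) (z ^+ 2) Hi Hj Hl E => X Y Z Hi Hj Hl E.
by clear -n7 Hi Hj Hl E; case: Hi => Hi; case: Hj => Hj; case: Hl => Hl; lia.
Qed.

(** * Counting *)

Import numFieldNormedType.Exports.
Local Open Scope classical_set_scope.
Local Open Scope ring_scope.

Lemma S3_small (R : realType) n : (n < 4)%N -> ~ S3 n.
Proof.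
have [b1 b2 b3] := b3_small; have b0 := b3_0.
by case: n => [|[|[|[|//]]]] _; apply; apply: (three_squares_thm R);
  rewrite ?b0 ?b1 ?b2 ?b3.
Qed.

Lemma S3_not_same_sign (R : realType) k r : (0 < k)%N -> ~~ same_sign k -> (r < 4)%N ->
  ~ S3 (r + 4 * k).
Proof.
move=> k0 sk r4; apply; have := b3_not_same_sign k r k0 sk r4.
by move: (b 3 _) => m m4; apply: (three_squares_thm R); clear -m4; lia.
Qed.

(** All four values are divisible by 4, and a factor 4 does not affect representability; the
    quotient is 7 modulo 8 exactly at [r0]. *)
Lemma S3_same_sign (R : realType) k : (0 < k)%N -> same_sign k ->
  exists2 r0, (r0 < 4)%N & forall r, (r < 4)%N -> S3 (r + 4 * k) <-> r = r0.
Proof.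
move=> k0 sk; have [r0 [r04 H]] := b3_same_sign k k0 sk.
exists r0 => // r r4; have := H r r4; rewrite /S3 /= -/(three_squares _).
case: eqVneq => [->|ne]; move: (b 3 _) => m m32.
  have mE : m = (4 * (m %/ 4))%N by clear -m32; lia.
  split=> // _; rewrite mE => /three_squares_4; apply: not_three_squares_7.
  by clear -m32; lia.
split=> [|rr]; last by rewrite rr eqxx in ne.
have mE : m = (2 ^ 2 * (m %/ 4))%N.
  by move: m32; rewrite !inE => /or3P[] /eqP h; clear -h; lia.
case; rewrite mE; apply: three_squares_scale; apply: (three_squares_thm R);
  by move: m32; rewrite !inE => /or3P[] /eqP h; clear -h; lia.
Qed.

Definition S3_count N := count (fun n => `[< S3 n >]) (iota 0 N.+1).

Lemma counting_funE (R : realType) (x : R) : 0 <= x ->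
  counting_fun S3 x = S3_count (Num.truncn x).
Proof.
move=> x0; rewrite /counting_fun /S3_count.
set s := [seq n <- iota 0 (Num.truncn x).+1 | `[< S3 n >]].
have -> : upto S3 x = [set` [fset n in s]%fset].
  apply/seteqP; split=> n /=; rewrite !inE mem_filter mem_iota add0n ltnS.
    by move=> [Sn nx]; rewrite truncn_ge_nat // nx !andbT; apply/asboolP.
  by move=> /and3P[/asboolP Sn _]; rewrite truncn_ge_nat.
rewrite set_fsetK card_fseq undup_id ?size_filter //.
by rewrite filter_uniq // iota_uniq.
Qed.

Definition sign_count K := count same_sign (iota 1 K).

Lemma sign_countS K : sign_count K.+1 = (sign_count K + same_sign K.+1)%N.
Proof. by rewrite /sign_count -[K.+1 in LHS]addn1 iotaD count_cat /= addn0 add1n. Qed.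

Lemma S3_count_block (R : realType) K : S3_count (4 * K + 3) = sign_count K.
Proof.
elim: K => [|K IH].
  apply/eqP; rewrite [X in _ == X](_ : _ = 0%N) // eqn0Ngt -has_count; apply/hasPn => n.
  by rewrite mem_iota => /= n4; apply/asboolPn; apply: (S3_small R).
rewrite sign_countS -IH /S3_count.
have -> : ((4 * K.+1 + 3).+1 = (4 * K + 3).+1 + 4)%N by lia.
rewrite iotaD count_cat add0n; congr (_ + _)%N.
have -> : iota (4 * K + 3).+1 4 = [seq (r + 4 * K.+1)%N | r <- iota 0 4].
  by rewrite /=; do !congr (_ :: _); lia.
rewrite count_map; case: (boolP (same_sign K.+1)) => sk.
  have [r0 r04 H] := S3_same_sign R K.+1 isT sk.
  rewrite (@eq_in_count _ _ (pred1 r0)) => [|r].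
    by rewrite count_uniq_mem ?iota_uniq // mem_iota r04.
  rewrite mem_iota => /= r4; apply/asboolP/eqP; by case: (H r r4).
apply/eqP; rewrite eqn0Ngt -has_count; apply/hasPn => r.
by rewrite mem_iota => /= r4; apply/asboolPn; apply: (S3_not_same_sign R).
Qed.

Lemma S3_count_mono m n : (m <= n)%N -> (S3_count m <= S3_count n)%N.
Proof.
move=> mn; rewrite /S3_count; have -> : (n.+1 = m.+1 + (n - m))%N by lia.
by rewrite iotaD count_cat leq_addr.
Qed.

(** Odd numbers are never counted, and 2 j is counted exactly when j is not. *)
Lemma sign_count_double K (e : bool) : (sign_count (e + K.*2) + sign_count K = K)%N.
Proof.
have even j : (sign_count j.*2 + sign_count j = j)%N.
  elim: j => [//|j IH]; rewrite doubleS !sign_countS same_sign_odd -doubleS.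
  by rewrite same_sign_double //; case: (same_sign j.+1); lia.
case: e; last exact: even.
by rewrite add1n sign_countS same_sign_odd addn0 even.
Qed.

Lemma sign_count_quadruple L (e1 e0 : bool) :
  sign_count (e0 + (e1 + L.*2).*2) = (L + e1 + sign_count L)%N.
Proof.
by have := sign_count_double (e1 + L.*2) e0; have := sign_count_double L e1; lia.
Qed.

(** * The deviation from K / 3 and the logarithmic bounds *)

Section Discrepancy.
Context {R : realType}.

Definition discrepancy K : R := (sign_count K)%:R - K%:R / 3.

Lemma discrepancy_quadruple L (e1 e0 : bool) :
  discrepancy (e0 + (e1 + L.*2).*2) =
  discrepancy L + ((e1 : nat)%:R - (e0 : nat)%:R) / 3.
Proof.
rewrite /discrepancy sign_count_quadruple.
have -> : (e0 + (e1 + L.*2).*2 = e0 + e1 * 2 + L * 4)%N by lia.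
by rewrite !natrD !natrM; field.
Qed.

Lemma ln2_gt0 : 0 < ln 2 :> R.
Proof. by apply: lt_le_trans (ln2_ge (R := R)); lra. Qed.

Lemma log2_le (x y : R) : 0 < x -> x <= y -> log2 x <= log2 y.
Proof.
move=> x0 xy; rewrite /log2 ler_wpM2r ?invr_ge0 ?(ltW ln2_gt0) //.
by rewrite ler_ln ?posrE // (lt_le_trans x0).
Qed.

Lemma log2_ge0 (x : R) : 1 <= x -> 0 <= log2 x.
Proof. by move=> x1; rewrite /log2 divr_ge0 ?ln_ge0 ?ler1n. Qed.

Lemma log2_mul2 (x : R) : 0 < x -> log2 (2 * x) = 1 + log2 x.
Proof.
by move=> x0; rewrite /log2 lnM ?posrE // mulrDl divff // gt_eqF // ln2_gt0.
Qed.

Lemma log2_mul4 (x : R) : 0 < x -> log2 (4 * x) = 2 + log2 x.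
Proof.
move=> x0; have -> : 4 * x = 2 * (2 * x) by ring.
by rewrite !log2_mul2 ?mulr_gt0 //; ring.
Qed.

Lemma log2_quadruple L (e1 e0 : bool) : (0 < L)%N ->
  2 + log2 L%:R <= log2 (e0 + (e1 + L.*2).*2)%:R :> R.
Proof.
move=> L0; rewrite -log2_mul4 ?ltr0n //; apply: log2_le; first by rewrite mulr_gt0 ?ltr0n.
by rewrite -natrM ler_nat; lia.
Qed.

Lemma base4_ind (P : nat -> Prop) : P 1%N -> P 2%N -> P 3%N ->
  (forall L (e1 e0 : bool), (0 < L)%N -> P L -> P (e0 + (e1 + L.*2).*2)%N) ->
  forall K, (0 < K)%N -> P K.
Proof.
move=> P1 P2 P3 PS; elim/ltn_ind => K IH K0; have [K4|K4] := ltnP K 4.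
  by case: K K0 K4 {IH} => [|[|[|[|]]]].
have -> : K = (odd K + (odd K./2 + K./2./2.*2).*2)%N.
  by rewrite !odd_double_half.
by apply: PS; [lia|apply: IH; lia].
Qed.

Lemma discrepancy_small : [/\ discrepancy 1 = - (1 / 3), discrepancy 2 = 1 / 3 & discrepancy 3 = 0].
Proof.
have E : discrepancy 0 = 0 by rewrite /discrepancy mul0r subr0.
split; [have := discrepancy_quadruple 0 false true|have := discrepancy_quadruple 0 true false
  |have := discrepancy_quadruple 0 true true]; rewrite E /= => ->; lra.
Qed.

Lemma log2_small : [/\ log2 1 = 0 :> R, log2 2%:R = 1 :> R & 0 <= log2 3%:R :> R].
Proof.
split; first by rewrite /log2 ln1 mul0r.
  by rewrite /log2 divff // gt_eqF // ln2_gt0.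
by apply: log2_ge0; rewrite ler1n.
Qed.

(** A further base 4 digit adds at most 1 / 3 to the discrepancy and at least 2 to [log2], whence
    the factor 1 / 6; K = 2 attains equality. *)
Lemma discrepancy_upper K : (0 < K)%N -> discrepancy K <= 1 / 6 * log2 K%:R + 1 / 6.
Proof.
have [d1 d2 d3] := discrepancy_small; have [l1 l2 l3] := log2_small.
elim/base4_ind => [||| L e1 e0 L0 IH]; rewrite ?d1 ?d2 ?d3 ?l1 ?l2; try lra.
rewrite discrepancy_quadruple; have := log2_quadruple L e1 e0 L0; move: IH.
by case: e1; case: e0 => /=; lra.
Qed.

Lemma discrepancy_lower K : (0 < K)%N -> - (1 / 6) * log2 K%:R - 1 / 3 <= discrepancy K.
Proof.
have [d1 d2 d3] := discrepancy_small; have [l1 l2 l3] := log2_small.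
elim/base4_ind => [||| L e1 e0 L0 IH]; rewrite ?d1 ?d2 ?d3 ?l1 ?l2; try lra.
rewrite discrepancy_quadruple; have := log2_quadruple L e1 e0 L0; move: IH.
by case: e1; case: e0 => /=; lra.
Qed.

(** A gain of 2 / 3 over [discrepancy_lower]: such K end in the base 4 digit 2, where both the digit
    and the growth of [log2] contribute 1 / 3, or in 0, where the claim is inherited from K / 4. *)
Lemma discrepancy_lower_same_sign K : (0 < K)%N -> same_sign K ->
  - (1 / 6) * log2 K%:R + 1 / 3 <= discrepancy K.
Proof.
have [d1 d2 d3] := discrepancy_small; have [l1 l2 l3] := log2_small.
elim/base4_ind => [||| L e1 e0 L0 IH]; rewrite ?d1 ?d2 ?d3 ?l1 ?l2; try lra.
- by rewrite (same_sign_odd 0).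
- by rewrite (same_sign_odd 1).
have := log2_quadruple L e1 e0 L0; rewrite discrepancy_quadruple.
case: e0; first by rewrite add1n same_sign_odd.
rewrite add0n same_sign_double; last by lia.
case: e1; first by rewrite add1n => h _; have := discrepancy_lower L L0; move: h => /=; lra.
by rewrite add0n same_sign_double // negbK => h /IH; move: h => /=; lra.
Qed.

Lemma S3_upper (x : R) : 2 <= x ->
  (counting_fun S3 x)%:R - x / 12 <= 1 / 6 * log2 x - 1 / 6.
Proof.
move=> x2; have x0 : 0 <= x by lra.
rewrite counting_funE //; set N := Num.truncn x; pose K := (N %/ 4)%N.
have /andP[Nx xN] := truncn_itv x0; rewrite -/N in Nx xN.
have NK : (N <= 4 * K + 3)%N by clear; rewrite /K; lia.
have cU : (S3_count N <= sign_count K)%N by rewrite -(S3_count_block R) S3_count_mono.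
(* For K = 0 nothing is counted, and x >= 2 makes the right-hand side nonnegative. *)
have [K0|K0] := posnP K.
  have l2 : 1 <= log2 x by have [_ <- _] := log2_small; apply: log2_le.
  have -> : S3_count N = 0%N by move: cU; rewrite K0; case: S3_count.
  by lra.
have KR : 0 < K%:R :> R by rewrite ltr0n.
have Kx : 4 * K%:R <= x.
  by apply: le_trans Nx; rewrite -natrM ler_nat; clear; rewrite /K; lia.
have K40 : 0 < 4 * K%:R :> R by rewrite mulr_gt0.
have := log2_le _ _ K40 Kx; rewrite log2_mul4 // => hlog.
have := discrepancy_upper K K0; rewrite /discrepancy.
have : (S3_count N)%:R <= (sign_count K)%:R :> R by rewrite ler_nat.
by lra.
Qed.

Lemma S3_lower (x : R) : 1 <= x ->
  - (1 / 6) * log2 x - 7 / 12 < (counting_fun S3 x)%:R - x / 12.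
Proof.
move=> x1; have x0 : 0 <= x by lra.
have lx := log2_ge0 x x1.
rewrite counting_funE //; set N := Num.truncn x; pose K := (N %/ 4)%N.
have /andP[Nx xN] := truncn_itv x0; rewrite -/N in Nx xN.
have c0 : 0 <= (S3_count N)%:R :> R by rewrite ler0n.
have NK : (N <= 4 * K + 3)%N by clear; rewrite /K; lia.
have xK : x < 4 * K%:R + 4.
  by apply: lt_le_trans xN _; rewrite -natrM -natrD ler_nat; clear -NK; lia.
have [K0|K0] := posnP K.
  by move: xK; rewrite K0; lra.
have KR : 0 < K%:R :> R by rewrite ltr0n.
have Kx : 4 * K%:R <= x.
  by apply: le_trans Nx; rewrite -natrM ler_nat; clear; rewrite /K; lia.
have K40 : 0 < 4 * K%:R :> R by rewrite mulr_gt0.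
have := log2_le _ _ K40 Kx; rewrite log2_mul4 // => hlog.
have cU : (sign_count K.-1 <= S3_count N)%N.
  rewrite -(S3_count_block R) S3_count_mono //; move: K0; clear; rewrite /K; lia.
have OK : sign_count K = (sign_count K.-1 + same_sign K)%N.
  by rewrite -{1}(prednK K0) sign_countS prednK.
have [N3|N3] := eqVneq N (4 * K + 3)%N.
  have := discrepancy_lower K K0; rewrite /discrepancy N3 (S3_count_block R).
  by lra.
have cR : (sign_count K.-1)%:R <= (S3_count N)%:R :> R by rewrite ler_nat.
(* In an unfinished block of the counted kind the element may still lie above x. The loss of 1 is
   offset by the sharper lower bound and by x < 4 K + 3; the constant 7 / 12 comes from this
   case. *)
case: (boolP (same_sign K)) => sk; rewrite ?sk ?(negbTE sk) in OK.
  have xK3 : x < 4 * K%:R + 3.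
    apply: lt_le_trans xN _; rewrite -natrM -natrD ler_nat; move: NK N3; clear; lia.
  have := discrepancy_lower_same_sign K K0 sk; rewrite /discrepancy OK natrD.
  by rewrite [true%:R]mulr1n; lra.
have := discrepancy_lower K K0; rewrite /discrepancy OK natrD [false%:R]mulr0n.
by lra.
Qed.
End Discrepancy.

(** * The density and the extremal sequences *)

Lemma log2_le_sqrt (R : realType) (x : R) : 1 <= x -> log2 x <= 4 * Num.sqrt x.
Proof.
move=> x1; have s1 : 1 <= Num.sqrt x by rewrite -[leLHS]sqrtr1 ler_wsqrtr.
have s0 : 0 < Num.sqrt x by apply: lt_le_trans s1.
have l2 := @ln2_ge R.
rewrite /log2 ler_pdivrMr ?ln2_gt0 //.
have : ln (1 + (Num.sqrt x - 1)) <= Num.sqrt x - 1 by apply: le_ln1Dx; lra.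
rewrite addrC subrK => hl.
have -> : ln x = 2 * ln (Num.sqrt x).
  have xE : x = Num.sqrt x * Num.sqrt x by rewrite -expr2 sqr_sqrtr //; lra.
  by rewrite {1}xE lnM ?posrE //; ring.
have : 4 * Num.sqrt x * (1 / 2) <= 4 * Num.sqrt x * ln 2.
  by rewrite ler_wpM2l // mulr_ge0 // ltW.
by lra.
Qed.

Lemma S3_density (R : realType) :
  (counting_fun S3 x)%:R / x @[x --> +oo] --> (1 / 12 : R).
Proof.
apply/cvgrPdist_le => e e0; near=> x.
have x2 : 2 <= x by near: x; apply: nbhs_pinfty_ge; rewrite num_real.
(* Chosen so that the error, at most 2 sqrt x, is at most e x. *)
have xe : (2 / e) ^+ 2 <= x by near: x; apply: nbhs_pinfty_ge; rewrite num_real.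
have x1 : 1 <= x by lra.
have x0 : 0 < x by lra.
have s0 : 0 < Num.sqrt x by rewrite sqrtr_gt0.
have s1 : 1 <= Num.sqrt x by rewrite -[leLHS]sqrtr1 ler_wsqrtr.
have lx := log2_le_sqrt _ x x1.
have := S3_upper x x2; have := S3_lower x x1 => hL hU.
have se : 2 / e <= Num.sqrt x.
  by rewrite -[leLHS]ger0_norm ?divr_ge0 ?(ltW e0) // -sqrtr_sqr ler_wsqrtr.
have es : 2 <= e * Num.sqrt x by move: se; rewrite ler_pdivrMr // mulrC.
have -> : 1 / 12 - (counting_fun S3 x)%:R / x = - ((counting_fun S3 x)%:R - x / 12) / x.
  by field; rewrite gt_eqF.
rewrite normrM normrN normfV (gtr0_norm x0) ler_pdivrMr //.
apply: (@le_trans _ _ (2 * Num.sqrt x)).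
  by rewrite ler_norml; apply/andP; split; lra.
have {2}-> : x = Num.sqrt x * Num.sqrt x by rewrite -expr2 sqr_sqrtr // ltW.
by rewrite mulrA ler_wpM2r // ltW.
Unshelve. all: by end_near.
Qed.

Lemma S3_natural_density (R : realType) : has_natural_density S3 (1 / 12 : R).
Proof. exact: cvg_comp (@cvgr_idn R) (S3_density R). Qed.

(* The number whose l digits in base 4 are all equal to d. *)
Fixpoint block_repeat (d l : nat) : nat := if l is j.+1 then 4 * block_repeat d j + d else 0.

Lemma block_repeatE d l : (3 * block_repeat d l + d = d * 4 ^ l)%N.
Proof.
elim: l => [|l IH]; first by rewrite muln0 add0n expn0 muln1.
by rewrite /= expnS; move: IH; lia.
Qed.

Lemma block_repeat_ltn d i j : (0 < d)%N -> (i < j)%N ->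
  (4 * block_repeat d i + 3 < 4 * block_repeat d j + 3)%N.
Proof.
move=> d0; elim: j => // j IH; rewrite ltnS leq_eqVlt => /orP[/eqP ->|/IH] /=; lia.
Qed.

(** The repeated base 4 digit is [e1 e0] in binary: each 2 adds 1 / 3 and each 1 subtracts it. *)
Lemma discrepancy_block (R : realType) (e1 e0 : bool) l :
  discrepancy (block_repeat (e0 + e1 * 2) l) = ((e1 : nat)%:R - (e0 : nat)%:R) * l%:R / 3 :> R.
Proof.
elim: l => [|l IH]; first by rewrite /discrepancy /= mul0r mulr0 mul0r subr0.
rewrite /=; have -> : (4 * block_repeat (e0 + e1 * 2) l + (e0 + e1 * 2) =
    e0 + (e1 + (block_repeat (e0 + e1 * 2) l).*2).*2)%N by lia.
by rewrite discrepancy_quadruple IH -natr1; ring.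
Qed.

Lemma S3_at_block_end (R : realType) K :
  (counting_fun S3 ((4 * K + 3)%N%:R : R))%:R - (4 * K + 3)%N%:R / 12 =
  discrepancy K - 1 / 4 :> R.
Proof.
rewrite counting_funE ?ler0n // natrK (S3_count_block R) /discrepancy natrD natrM.
by field.
Qed.

Lemma log2_block (R : realType) d l : (0 < d < 3)%N ->
  2 * l%:R <= log2 ((4 * block_repeat d l + 3)%N%:R : R) <= 2 * l%:R + 2.
Proof.
move=> d3; have E := block_repeatE d l.
have log4 j : log2 ((4 ^ j)%N%:R : R) = 2 * j%:R.
  elim: j => [|j IH]; first by have [-> _ _] := @log2_small R; rewrite mulr0.
  by rewrite expnS natrM log2_mul4 ?ltr0n ?expn_gt0 // IH -natr1; ring.
have -> : 2 * l%:R + 2 = 2 * l.+1%:R :> R by rewrite -natr1; ring.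
rewrite -!log4; apply/andP; split; apply: log2_le; rewrite ?ltr0n ?expn_gt0 ?addn3 // ler_nat;
  by rewrite ?expnS; case: d d3 E => [|[|[|]]] //= _; lia.
Qed.

Lemma asymp_equiv_near (R : realType) (a c : nat -> R) :
  (forall l, `|a l - c l| <= 1) -> (forall l, l%:R / 3 <= `|c l|) -> asymp_equiv a c.
Proof.
move=> ac cl; apply/cvgrPdist_le => e e0; near=> l.
have le_l : 3 / e <= l%:R.
  near: l; exists (Num.truncn (3 / e)).+1 => // j /= jl.
  by apply: ltW; apply: lt_le_trans (truncnS_gt _) _; rewrite ler_nat.
have h3 : 0 < 3 / e :> R by rewrite divr_gt0.
have c0 : 0 < `|c l| by apply: lt_le_trans (cl l); rewrite divr_gt0 //; exact: lt_le_trans le_l.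
have cn0 : c l != 0 by rewrite -normr_gt0.
have -> : 1 - a l / c l = - (a l - c l) / c l by field.
rewrite normrM normrN normfV ler_pdivrMr //; apply: le_trans (ac l) _.
have : e * (l%:R / 3) <= e * `|c l| by rewrite ler_wpM2l // ltW.
apply: le_trans; move: le_l; rewrite ler_pdivrMr // => h.
by rewrite mulrA ler_pdivlMr // mul1r mulrC.
Unshelve. all: by end_near.
Qed.

Lemma asymp_equiv_upper (R : realType) :
  asymp_equiv
    (fun l => (counting_fun S3 ((4 * block_repeat 2 l + 3)%N%:R : R))%:R
       - (4 * block_repeat 2 l + 3)%N%:R / 12)
    (fun l => 1 / 6 * log2 ((4 * block_repeat 2 l + 3)%N%:R : R)).
Proof.
(* The first sequence is l / 3 - 1 / 4, and the second lies between l / 3 and l / 3 + 1 / 3. *)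
apply: asymp_equiv_near => l; have /andP[h1 h2] := @log2_block R 2 l isT;
  have l0 : 0 <= l%:R :> R := ler0n _ _.
  rewrite S3_at_block_end (discrepancy_block R true false l) /=.
  by rewrite ler_norml; apply/andP; split; lra.
by rewrite ger0_norm; lra.
Qed.

Lemma asymp_equiv_lower (R : realType) :
  asymp_equiv
    (fun l => (counting_fun S3 ((4 * block_repeat 1 l + 3)%N%:R : R))%:R
       - (4 * block_repeat 1 l + 3)%N%:R / 12)
    (fun l => - (1 / 6) * log2 ((4 * block_repeat 1 l + 3)%N%:R : R)).
Proof.
apply: asymp_equiv_near => l; have /andP[h1 h2] := @log2_block R 1 l isT;
  have l0 : 0 <= l%:R :> R := ler0n _ _.
  rewrite S3_at_block_end (discrepancy_block R false true l) /=.
  by rewrite ler_norml; apply/andP; split; lra.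
by rewrite mulNr normrN ger0_norm; lra.
Qed.

(* The upper bound starts at 2: it is false at x = 1, where S3(1) = 0 but        *)
(* - 1 / 12 > - 1 / 6.                                                          *)
Theorem theorem6p2 (R : realType) :
  [/\ forall x : R, 1 <= x ->
        - (1 / 6) * log2 x - 7 / 12 < (counting_fun S3 x)%:R - x / 12,
      forall x : R, 2 <= x ->
        (counting_fun S3 x)%:R - x / 12 <= 1 / 6 * log2 x - 1 / 6,
      has_natural_density S3 (1 / 12 : R),
      (counting_fun S3 x)%:R / x @[x --> +oo] --> (1 / 12 : R)
    & exists m n : nat -> nat,
        [/\ {homo m : i j / (i < j)%N}, {homo n : i j / (i < j)%N},
            asymp_equiv
              (fun l => (counting_fun S3 ((m l)%:R : R))%:R - (m l)%:R / 12)
              (fun l => 1 / 6 * log2 ((m l)%:R : R))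
          & asymp_equiv
              (fun l => (counting_fun S3 ((n l)%:R : R))%:R - (n l)%:R / 12)
              (fun l => - (1 / 6) * log2 ((n l)%:R : R))]].
Proof.
split; [exact: S3_lower|exact: S3_upper|exact: S3_natural_density|exact: S3_density|].
exists (fun l => (4 * block_repeat 2 l + 3)%N), (fun l => (4 * block_repeat 1 l + 3)%N).
split; [| |exact: asymp_equiv_upper|exact: asymp_equiv_lower] => i j /=;
  exact: block_repeat_ltn.
Qed.
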